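(* The explosion point of $\phi$ equals $r^*$, i.e. $\sup\{r\in\mathbb R:\phi(r)<\infty\}=r^*$, and $$\phi(r)=F^{-1}\big(\log r^*-\log r\big)\qquad\text{for all } 0<r<r^*.$$
   Context: Let $(\mathbf Z_n)_{n\ge 0}$ be the branching random walk on $\mathbb R_+^2$ started from a single particle at the origin, in which every particle of generation $n$ located at $y\in\mathbb R_+^2$ gives birth, independently of all other particles, to children located at $y+z$, where $z$ ranges over the atoms of an independent copy of a Poisson point process on $(0,\infty)^2$ whose intensity is Lebesgue measure $\mathrm dt\,\mathrm dx$; $\mathbf Z_n$ denotes the point measure of positions of generation $n$ (so $\mathbf Z_0=\delta_{(0,0)}$). Set $W_n=\int_{\mathbb R_+^2} e^{-t-x}\,\mathbf Z_n(\mathrm dt,\mathrm dx)$; $(W_n)_{n\ge0}$ is a nonnegative martingale of mean $1$ converging almost surely and in $L^1$ to a limit $W$ with $\mathbb E W=1$. Let $\phi(s)=\mathbb E(e^{sW})\in(0,\infty]$ for $s\in\mathbb R$. Define $$r^*=\exp\Big(\int_0^\infty\Big(\big(2(e^u-u-1)\big)^{-1/2}-u^{-1}\mathbf 1_{\{u<1\}}\Big)\mathrm du\Big)\in(0,\infty),$$ and $F:(1,\infty)\to(0,\infty)$, $F(y)=\int_{\log y}^\infty \frac{\mathrm du}{\sqrt{2(e^u-u-1)}}$, which is a strictly decreasing bijection with inverse $F^{-1}$. *)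

(* Defs.v *)
From HB Require Import structures.
From mathcomp Require Import all_boot all_order all_algebra.
From mathcomp Require Import all_classical all_reals all_analysis.
Set Implicit Arguments. Unset Strict Implicit. Unset Printing Implicit Defensive.
Import Order.TTheory GRing.Theory Num.Theory.
Import numFieldNormedType.Exports.
Local Open Scope classical_set_scope.
Local Open Scope ring_scope.

Section BRW.
Context {R : realType}.

Definition leb2 : set (R * R) -> \bar R :=
  (@lebesgue_measure R \x @lebesgue_measure R)%E.

Definition quadrant : set (R * R) := [set z | 0 < z.1 /\ 0 < z.2].

(** Poisson(m) probability mass function (m >= 0; 0^0 = 1). *)
Definition ppmf (m : R) (k : nat) : R := expR (- m) * m ^+ k / k`!%:R.

Definition count_in (z : nat -> R * R) (A : set (R * R)) : \bar R :=
  (\sum_(0 <= k <oo) (\1_A (z k) : R)%:E)%E.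

Context {d : measure_display} {T : measurableType d} (P : probability T R).

(** [z] (an enumeration of the atoms of a random point measure on (0,oo)^2)
    is a Poisson point process on (0,oo)^2 with intensity Lebesgue measure:
    the counts of finitely many pairwise disjoint measurable subsets of
    finite Lebesgue measure are independent Poisson variables with means
    their Lebesgue measures. *)
Definition lebesgue_PPP (z : nat -> T -> R * R) : Prop :=
  (forall k, measurable_fun setT (z k)) /\
  (forall k w, quadrant (z k w)) /\
  forall (m : nat) (A : 'I_m -> set (R * R)) (c : 'I_m -> nat),
    (forall i, measurable (A i) /\ A i `<=` quadrant /\ (leb2 (A i) < +oo)%E) ->
    (forall i j, i != j -> A i `&` A j = set0) ->
    P (\bigcap_(i in [set: 'I_m])
         [set w | count_in (fun k => z k w) (A i) = ((c i)%:R)%:E])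
    = (\prod_(i < m) ppmf (fine (leb2 (A i))) (c i))%:E.

Definition gen_sigma (z : nat -> T -> R * R) : set (set T) :=
  <<s [set E | exists k (A : set (R * R)), measurable A /\ E = z k @^-1` A] >>.

Definition mutually_indep (xi : seq nat -> nat -> T -> R * R) : Prop :=
  forall (m : nat) (u : 'I_m -> seq nat) (E : 'I_m -> set T),
    injective u -> (forall i, gen_sigma (xi (u i)) (E i)) ->
    P (\bigcap_(i in [set: 'I_m]) E i) = (\prod_(i < m) P (E i))%E.

(** Ulam-Harris encoding: the vertex [u : seq nat] is a particle of
    generation [size u]; its [k]-th child [rcons u k] is displaced by
    [xi u k] from it.  [pos xi u w] is the position of particle [u]. *)
Fixpoint pos_aux (xi : seq nat -> nat -> T -> R * R) (pref u : seq nat) (w : T)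
  : R * R :=
  match u with
  | [::] => (0, 0)
  | k :: u' => let a := xi pref k w in let b := pos_aux xi (rcons pref k) u' w in
               (a.1 + b.1, a.2 + b.2)
  end.
Definition pos xi (u : seq nat) w := pos_aux xi [::] u w.

(** W_n = int e^{-t-x} Z_n(dt,dx) *)
Definition Wn (xi : seq nat -> nat -> T -> R * R) (n : nat) (w : T) : \bar R :=
  (\esum_(u in [set u : seq nat | size u = n])
     (expR (- (pos xi u w).1 - (pos xi u w).2))%:E)%E.

Definition mgf (W : T -> R) (s : R) : \bar R :=
  (\int[P]_w (expR (s * W w))%:E)%E.

End BRW.

Definition rstar_integrand {R : realType} (u : R) : R :=
  (Num.sqrt (2 * (expR u - u - 1)))^-1 - (if u < 1 then u^-1 else 0).

Definition rstar (R : realType) : R :=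
  expR (fine (\int[@lebesgue_measure R]_(u in `]0%R, +oo[) (rstar_integrand u)%:E)%E).

Definition F {R : realType} (y : R) : R :=
  fine (\int[@lebesgue_measure R]_(u in `[ln y, +oo[)
          ((Num.sqrt (2 * (expR u - u - 1)))^-1)%:E)%E.

(** F^{-1} : (0,oo) -> (1,oo), the inverse of the bijection F : (1,oo) -> (0,oo) *)
Definition Finv {R : realType} (z : R) : R := xget 0 [set y : R | 1 < y /\ F y = z].

(* Main.v *)
(** Write phi_n for the moment generating function of W_n. Splitting at the
    first generation and using the Laplace functional of the Poisson process,
    [phi_(n+1)(s) = exp (int int (phi_n(s e^(-t-x)) - 1) dt dx)] with
    [phi_0(s) = e^s]. In the variable [v = log s] a fixed point [e^g] of this
    recursion satisfies [g'' = e^g - 1], hence [g' = sqrt (2 (e^g - g - 1))]; the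
    solution with [g(v) ~ e^v] at [-oo] is the inverse of
    [x |-> log r* - F(e^x)] and blows up at [log r*]. It dominates all the
    [phi_n], and the gap between [g] and [log phi_n] is at least halved, in a
    weighted supremum norm on each half-line bounded above below [log r*], at
    every step. So [phi_n] converges to [e^g] below [r*], and the finiteness at
    slightly larger parameters makes [exp (s W_n)] uniformly integrable. *)
Require Import Defs.
From HB Require Import structures.
From mathcomp Require Import all_boot all_order all_algebra.
From mathcomp Require Import all_classical all_reals all_analysis.
From mathcomp Require Import measurable_realfun ring lra.
Set Implicit Arguments. Unset Strict Implicit. Unset Printing Implicit Defensive.
Import Order.TTheory GRing.Theory Num.Theory.
Import numFieldNormedType.Exports.
Local Open Scope classical_set_scope.
Local Open Scope ring_scope.

(** * Extended exponential *)

(** The obstacle is the mode [expR v]. The double integral of the recursion multiplies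
    [expR (k * v)] by [k ^- 2]: a gap of order [expR v] would never shrink, while one of order
    [expR (2 * v)] loses a factor 4 where the linearisation factor e^g is close to 1. Hence g must
    agree with [expR v] at -oo up to an error of order [expR (2 * v)], which is what the regularised
    integral in [rstar] provides. Further right e^g may be large; the weight therefore contains a
    second term, a high power of [expR v], which the double integral reduces enough to absorb that
    factor. A priori [Wn] and [phi n s] may be infinite. Exponentials, the Laplace functional and
    the recursion are therefore set in the extended reals, and finiteness below [rstar] only comes
    out of the comparison with g. *)

Section extended_exponential.
Context (R : realType).
Local Open Scope ereal_scope.

Lemma measurable_expeR : measurable_fun setT (@expeR R).
Proof.
apply: (measurability _ (ErealGenOInfty.measurableE R)).
move=> _ [_ [r ->] <-]; rewrite setTI.
have [r0|r0] := ltP r 0%R.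
  rewrite (_ : _ @^-1` _ = setT)//; apply/seteqP; split => // y _ /=.
  by rewrite in_itv/= andbT (lt_le_trans _ (expeR_ge0 _))// lte_fin.
(* The level [L] is [-oo] when [r] is 0. *)
have [L lK] : exists L, expeR L = r%:E by apply: expeR_total; rewrite lee_fin.
rewrite (_ : _ @^-1` _ = `]L, +oo[%classic).
  exact: emeasurable_itv.
by apply/seteqP; split => y /=; rewrite !in_itv/= !andbT -lK lte_expeR.
Qed.

Lemma measurable_lne : measurable_fun setT (@lne R).
Proof.
apply: (measurability _ (ErealGenOInfty.measurableE R)).
move=> _ [_ [r ->] <-]; rewrite setTI.
rewrite (_ : _ @^-1` _ = `]expeR r%:E, +oo[%classic).
  exact: emeasurable_itv.
apply/seteqP; split => y /=; rewrite !in_itv/= !andbT.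
- have [y0|y0] := leP y 0; first by rewrite le0_lneNy.
  rewrite -[in X in _ -> X](@lneK _ y); last by rewrite in_itv/= ltW ?leey.
  by rewrite -[(expR r)%:E]/(expeR r%:E) lte_expeR.
- move=> ry; rewrite -lte_expeR lneK// in_itv/= leey andbT ltW//.
  by rewrite (le_lt_trans _ ry)// lee_fin expR_ge0.
Qed.

Lemma cvg_expeR (u : (\bar R)^nat) (l : \bar R) : -oo < l ->
  u n @[n --> \oo] --> l -> expeR (u n) @[n --> \oo] --> expeR l.
Proof.
case: l => [l _ /fine_cvgP[fu ul]|_ uy|//] /=.
- apply: cvg_EFin.
    by move: fu; apply: filterS => n; case: (u n).
  suff : (expR \o (fine \o u)) n @[n --> \oo] --> expR l.
    apply: cvg_trans; apply: near_eq_cvg.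
    by move: fu; apply: filterS => n /=; case: (u n).
  by apply: cvg_comp ul _; exact: continuous_expR.
- apply/cvgeyPge => A; move/cvgeyPge : uy => /(_ A).
  apply: filterS => n uA.
  apply: le_trans (_ : expeR A%:E <= _); last by rewrite lee_expeR.
  by rewrite lee_fin (le_trans _ (expR_ge1Dx _))// lerDr.
Qed.

Lemma expeR_sum (I : Type) (r : seq I) (p : pred I) (a : I -> \bar R) :
  expeR (\sum_(i <- r | p i) a i) = \prod_(i <- r | p i) expeR (a i).
Proof. by apply: big_morph; [exact: expeRD|exact: expeR0]. Qed.

Lemma expeR_ge1 (x : \bar R) : 0 <= x -> 1 <= expeR x.
Proof. by move=> x0; rewrite -expeR0 lee_expeR. Qed.

Lemma lne_expeR_ge1 (x : \bar R) : 1 <= x -> expeR (lne x) = x.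
Proof. by move=> x1; rewrite lneK// in_itv/= leey andbT (le_trans _ x1). Qed.

Lemma emeasurable_prod (d : measure_display) (T : measurableType d)
    (I : Type) (r : seq I) (h : I -> T -> \bar R) :
  (forall i, measurable_fun setT (h i)) ->
  measurable_fun setT (fun w => \prod_(i <- r) h i w).
Proof.
move=> mh; elim: r => [|i r IH].
  by rewrite (_ : (fun _ => _) = cst 1)//; apply/funext => w; rewrite big_nil.
rewrite (_ : (fun _ => _) = fun w => h i w * \prod_(j <- r) h j w).
  exact: emeasurable_funM.
by apply/funext => w; rewrite big_cons.
Qed.

Lemma expeR_nneseries (a : (\bar R)^nat) : (forall n, 0 <= a n) ->
  \prod_(i < n) expeR (a i) @[n --> \oo] --> expeR (\sum_(0 <= i <oo) a i).
Proof.
move=> a0.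
rewrite (_ : (fun n => _) = fun n => expeR (\sum_(0 <= i < n) a i)); last first.
  by apply/funext => n; rewrite big_mkord expeR_sum.
apply: cvg_expeR; first by rewrite (lt_le_trans _ (nneseries_ge0 _)).
by apply: is_cvg_nneseries => n _ _; exact: a0.
Qed.

(** A series is an integral against the counting measure, so this is monotone convergence. *)
Lemma lim_nneseries_nd (a : nat -> nat -> \bar R) :
  (forall n k, 0 <= a n k) -> (forall k, {homo a ^~ k : m n / (m <= n)%N >-> m <= n}) ->
  limn (fun n => \sum_(0 <= k <oo) a n k) = \sum_(0 <= k <oo) limn (a ^~ k).
Proof.
move=> a0 nda.
rewrite -ge0_integral_count; last first.
  by move=> k; apply: lime_ge; [exact: ereal_nondecreasing_is_cvgn|exact: nearW].
rewrite (@monotone_convergence _ _ _ counting _ measurableT a)//.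
by apply: congr_lim; apply/funext => n; rewrite ge0_integral_count.
Qed.

End extended_exponential.

(** * Independence and the branching structure *)

Section independence.
Context (d : measure_display) (T : measurableType d) (R : realType)
  (P : probability T R).
Local Open Scope ereal_scope.

Lemma indep_right_dynkin (A : set T) : measurable A ->
  dynkin [set B | measurable B /\ P (A `&` B) = P A * P B].
Proof.
move=> mA; split => [|B [mB AB]|F tF FP] /=.
- by rewrite setIT probability_setT mule1.
- split; first exact: measurableC.
  have PD : P (A `\` B) = P A - P (A `&` B).
    by rewrite measureD// -ge0_fin_numE// fin_num_measure.
  by rewrite -setDE PD AB probability_setC// muleBr ?mule1 ?fin_num_measure.
- have mF n : measurable (F n) by have [] := FP n.
  split; first exact: bigcupT_measurable.
  rewrite setI_bigcupr.
  rewrite measure_bigcup//; last 2 first.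
  + by move=> n _; exact: measurableI.
  + exact: trivIset_setIl.
  rewrite [in RHS]measure_bigcup// -(@fineK _ (P A)) ?fin_num_measure//.
  rewrite -nneseriesZl//; apply: eq_eseriesr => n _.
  by rewrite fineK ?fin_num_measure//; have [] := FP n.
Qed.

(** The pi-lambda theorem is applied twice, enlarging one of the two generators at a time. *)
Lemma indep_pi_systems (G1 G2 : set (set T)) :
  G1 `<=` measurable -> G2 `<=` measurable ->
  setI_closed G1 -> setI_closed G2 ->
  (forall A B, G1 A -> G2 B -> P (A `&` B) = P A * P B) ->
  forall A B, <<s G1 >> A -> <<s G2 >> B -> P (A `&` B) = P A * P B.
Proof.
move=> mG1 mG2 I1 I2 G12 A B sA sB.
have step (G : set (set T)) C : setI_closed G -> measurable C ->
    G `<=` measurable -> (forall D, G D -> P (C `&` D) = P C * P D) ->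
    forall D, <<s G >> D -> P (C `&` D) = P C * P D.
  move=> IG mC mG GC D; rewrite -setI_closed_g_dynkin_g_sigma_algebra// => sD.
  suff [] : [set D | measurable D /\ P (C `&` D) = P C * P D] D by [].
  apply: sD; split; first exact: indep_right_dynkin.
  by move=> E GE; split; [exact: mG|exact: GC].
have mA : measurable A.
  by apply: (@smallest_sub _ (sigma_algebra setT) G1) => //; exact: sigma_algebra_measurable.
apply: (step G2) => // D G2D.
rewrite setIC muleC; apply: (step G1) => //; first exact: mG2.
by move=> E G1E; rewrite setIC muleC; exact: G12.
Qed.



Variables (G1 G2 : set (set T)).
Hypotheses (mG1 : G1 `<=` measurable) (mG2 : G2 `<=` measurable).
Hypotheses (IG1 : setI_closed G1) (IG2 : setI_closed G2).
Hypothesis G12 : forall A B, G1 A -> G2 B -> P (A `&` B) = P A * P B.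

(** Makes the identity a random variable with values in the coarser measurable space; its law is the
    restriction of [P]. *)
Lemma measurable_id_sub (G : set (set T)) : G `<=` measurable ->
  measurable_fun setT (id : T -> g_sigma_algebraType G).
Proof.
move=> mG _ A mA; rewrite setTI.
by apply: (@smallest_sub _ (sigma_algebra setT) G) => //; exact: sigma_algebra_measurable.
Qed.

Local Notation S1 := (g_sigma_algebraType G1).
Local Notation S2 := (g_sigma_algebraType G2).

(* The law of [w |-> (w, w)] on the product of the two sub-sigma-algebras is
   the product of the restrictions of [P]. *)
Lemma indep_fubini (f : S1 * S2 -> \bar R) : measurable_fun setT f ->
  (forall x, 0 <= f x) ->
  \int[P]_w f (w, w) = \int[P]_w \int[P]_w' f (w, w').
Proof.
move=> mf f0.
have m1 := measurable_id_sub mG1.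
have m2 := measurable_id_sub mG2.
have mdiag : measurable_fun setT (fun w : T => (w : S1, w : S2)).
  exact: measurable_fun_pair.
pose P1 : probability S1 R := distribution P (mfun_Sub (mem_set m1)).
pose P2 : probability S2 R := distribution P (mfun_Sub (mem_set m2)).
transitivity (\int[pushforward P (fun w : T => (w : S1, w : S2))]_z f z).
  by rewrite ge0_integral_pushforward.
transitivity (\int[P1 \x P2]_z f z).
  apply: eq_measure_integral => A mA _.
  symmetry; apply: product_measure_unique => // B C mB mC.
  rewrite /= /pushforward/=.
  exact: (indep_pi_systems mG1 mG2 IG1 IG2 G12).
have inner : fubini_F P2 f = fun x => \int[P]_w' f (x, w').
  apply/funext => x; rewrite /fubini_F ge0_integral_pushforward//.
  exact: measurable_fun_pair2.
rewrite fubini_tonelli1// ge0_integral_pushforward//.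
- by rewrite inner.
- exact: measurable_fun_fubini_tonelli_F.
- by move=> x _; exact: integral_ge0.
Qed.

End independence.

(** * Independence of disjoint sets of vertices *)

Section branching_independence.
Context (d : measure_display) (T : measurableType d) (R : realType)
  (P : probability T R) (xi : seq nat -> nat -> T -> R * R).
Local Open Scope ereal_scope.
Hypothesis mxi : forall u k, measurable_fun setT (xi u k).
Hypothesis ixi : mutually_indep P xi.

(** Finite cylinder events that depend only on the displacements issued from vertices of [S]: a
    pi-system for the sigma-algebra of that subfamily. The list [l] keeps the support finite. *)
Definition cyl (S : set (seq nat)) : set (set T) :=
  [set E | exists (F : seq nat -> set T) (l : seq (seq nat)),
     [/\ forall u, gen_sigma (xi u) (F u),
         forall u, F u = setT \/ (u \in l /\ S u) & E = \bigcap_u F u]].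

Lemma gen_sigma_measurable u E : gen_sigma (xi u) E -> measurable E.
Proof.
apply: (@smallest_sub _ (sigma_algebra setT)) => //.
  exact: sigma_algebra_measurable.
move=> _ [k [A [mA ->]]]; rewrite -[X in measurable X]setTI; exact: mxi.
Qed.

Lemma gen_sigmaT u : gen_sigma (xi u) setT.
Proof. exact: (@measurableT _ (g_sigma_algebraType _)). Qed.

Lemma gen_sigmaI u A B :
  gen_sigma (xi u) A -> gen_sigma (xi u) B -> gen_sigma (xi u) (A `&` B).
Proof. exact: (@measurableI _ (g_sigma_algebraType _)). Qed.

Lemma cyl_measurable S : cyl S `<=` measurable.
Proof.
move=> _ [F [l [Fm FS ->]]].
rewrite (_ : \bigcap_u F u = \bigcap_(u in [set` l]) F u); last first.
  apply/seteqP; split => [w Fw u _|w Fw u _]; first exact: Fw.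
  by have [->//|[ul _]] := FS u; exact: Fw.
apply: fin_bigcap_measurable => // u _; exact: gen_sigma_measurable (Fm u).
Qed.

Lemma cyl_setI_closed S : setI_closed (cyl S).
Proof.
move=> _ _ [F [l [Fm FS ->]]] [F' [l' [Fm' FS' ->]]].
exists (fun u => F u `&` F' u), (l ++ l'); split.
- by move=> u; exact: gen_sigmaI.
- move=> u; have [->|[ul Su]] := FS u; have [->|[ul' Su']] := FS' u.
  + by left; rewrite setIT.
  + by right; rewrite mem_cat ul' orbT.
  + by right; rewrite mem_cat ul.
  + by right; rewrite mem_cat ul.
- by rewrite -bigcapI.
Qed.

Lemma mutually_indep_cap (F : seq nat -> set T) (l : seq (seq nat)) :
  (forall u, gen_sigma (xi u) (F u)) -> uniq l ->
  (forall u, u \notin l -> F u = setT) ->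
  P (\bigcap_u F u) = \prod_(u <- l) P (F u).
Proof.
move=> Fm ul Fl.
have -> : \bigcap_u F u = \bigcap_(i in [set: 'I_(size l)]) F (tnth (in_tuple l) i).
  apply/seteqP; split => [w Fw i _|w Fw u _]; first exact: Fw.
  have [ul'|/Fl ->//] := boolP (u \in l).
  have /tnthP[i ->] : u \in in_tuple l by [].
  exact: Fw.
rewrite (ixi (u := tnth (in_tuple l))) //; last first.
  by apply/tuple_uniqP.
by rewrite [RHS]big_tnth.
Qed.

(** Both events are written over the merged support; at each vertex at least one of the two factors
    is [setT], so the product of probabilities splits vertex by vertex. *)
Lemma cyl_indep S S' : S `&` S' = set0 ->
  forall A B, cyl S A -> cyl S' B -> P (A `&` B) = P A * P B.
Proof.
move=> SS' _ _ [F [l [Fm FS ->]]] [F' [l' [Fm' FS' ->]]].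
have Fl u : u \notin undup (l ++ l') -> F u = setT.
  by have [->//|[ul _]] := FS u; rewrite mem_undup mem_cat ul.
have Fl' u : u \notin undup (l ++ l') -> F' u = setT.
  by have [->//|[ul _]] := FS' u; rewrite mem_undup mem_cat ul orbT.
rewrite -bigcapI (@mutually_indep_cap F (undup (l ++ l')))//; last exact: undup_uniq.
rewrite (@mutually_indep_cap F' (undup (l ++ l')))//; last exact: undup_uniq.
rewrite (@mutually_indep_cap _ (undup (l ++ l')))//; last 3 first.
- by move=> u; exact: gen_sigmaI.
- exact: undup_uniq.
- by move=> u uL; rewrite Fl// Fl'// setIT.
rewrite -big_split/=; apply: eq_bigr => u _.
have [->|[_ Su]] := FS u; first by rewrite setTI probability_setT mul1e.
have [->|[_ Su']] := FS' u; first by rewrite setIT probability_setT mule1.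
by have : (S `&` S') u by []; rewrite SS'.
Qed.

Lemma measurable_xi_cyl S u k : S u ->
  measurable_fun setT (xi u k : g_sigma_algebraType (cyl S) -> R * R).
Proof.
move=> Su _ A mA; rewrite setTI; apply: sub_sigma_algebra.
exists (fun v => if v == u then xi u k @^-1` A else setT), [:: u]; split.
- move=> v; case: eqP => [->|_]; last exact: gen_sigmaT.
  by apply: sub_sigma_algebra; exists k, A.
- move=> v; case: eqP => [->|_]; last by left.
  by right; rewrite mem_head.
- apply/seteqP; split => [w Aw v _|w /(_ u I)]; last by rewrite eqxx.
  by case: eqP.
Qed.

(** Independence of a set of vertices and its complement as an integration formula: what happens in
    [S] is averaged while everything outside is frozen. *)
Lemma branching_fubini (S : set (seq nat))
    (f : g_sigma_algebraType (cyl (~` S)) * g_sigma_algebraType (cyl S) -> \bar R) :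
  measurable_fun setT f -> (forall x, 0 <= f x) ->
  \int[P]_w f (w, w) = \int[P]_w \int[P]_w' f (w, w').
Proof.
apply: indep_fubini; try exact: cyl_measurable; try exact: cyl_setI_closed.
by apply: cyl_indep; rewrite setICl.
Qed.

End branching_independence.

(** * Decomposition of [Wn] at the first generation *)

Section recursion.
Context (R : realType).
Local Open Scope ereal_scope.

(** One inequality, used for [c] and then for its inverse, gives both. *)
Lemma esumZl (I : choiceType) (S : set I) (a : I -> \bar R) (c : R) : (0 < c)%R ->
  (forall i, 0 <= a i) ->
  \esum_(i in S) (c%:E * a i) = c%:E * \esum_(i in S) a i.
Proof.
have half (b : I -> \bar R) r : (0 < r)%R -> (forall i, 0 <= b i) ->
    \esum_(i in S) (r%:E * b i) <= r%:E * \esum_(i in S) b i.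
  move=> r0 b0; apply: ge_ereal_sup => _ [A [fA AS] <-].
  rewrite -ge0_mule_fsumr// lee_pmul2l//.
  by apply: ereal_sup_ubound; exists A.
move=> c0 a0; apply/eqP; rewrite eq_le half//=.
rewrite -[X in _ <= X]mul1e -(@divff _ c) ?gt_eqF// EFinM -muleA lee_pmul2l//.
rewrite [X in X <= _](_ : _ = \esum_(i in S) (c^-1%:E * (c%:E * a i))); last first.
  by apply: eq_esum => i _; rewrite muleA -EFinM mulVf ?gt_eqF// mul1e.
by apply: half; rewrite ?invr_gt0// => i; rewrite mule_ge0// lee_fin ltW.
Qed.

Definition wt (z : R * R) : R := expR (- z.1 - z.2).

Lemma measurable_wt : measurable_fun setT wt.
Proof.
apply: measurableT_comp => //; apply: measurable_funB => //.
exact: measurableT_comp.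
Qed.

Context (d : measure_display) (T : measurableType d).
Implicit Types xi : seq nat -> nat -> T -> R * R.

Lemma pos_aux_cons xi k p u w :
  pos_aux xi (k :: p) u w = pos_aux (fun v => xi (k :: v)) p u w.
Proof. by elim: u p => //= j u IH p; rewrite IH. Qed.

Lemma Wn0 xi w : Wn xi 0 w = 1.
Proof.
rewrite /Wn (_ : [set u | _] = [set [::]]); last first.
  by apply/seteqP; split => [u /size0nil ->//|u ->].
by rewrite esum_set1 ?lee_fin ?expR_ge0//= !subr0 oppr0 expR0.
Qed.

(** A word of length [n.+1] is a first letter [k] followed by a word of length [n]. The weight is
    multiplicative along a branch, and the subtree of child [k] is driven by the family shifted by
    [k]. *)
Lemma WnS xi n w : Wn xi n.+1 w =
  \sum_(0 <= k <oo) ((wt (xi [::] k w))%:E * Wn (fun u => xi (k :: u)) n w).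
Proof.
rewrite /Wn.
rewrite (_ : [set u | size u = n.+1] =
    \bigcup_(k in [set: nat]) [set k :: v | v in [set v : seq nat | size v = n]]); last first.
  apply/seteqP; split => [[|k v]//= [sv]|u [k _ [v sv <-]]]; first by exists k => //; exists v.
  by rewrite /= sv.
rewrite esum_bigcupT; last 2 first.
- by move=> i j _ _ [u [[v _ <-] [v' _ [-> _]]]].
- by move=> u; rewrite lee_fin expR_ge0.
rewrite nneseries_esumT; last first.
  by move=> k; rewrite mule_ge0 ?lee_fin ?expR_ge0// esum_ge0// => u _; rewrite lee_fin expR_ge0.
apply: eq_esum => k _.
rewrite (@reindex_esum _ _ _ [set v : seq nat | size v = n] _ (cons k)); last first.
  split; [by move=> v sv; exists v| by move=> v v' _ _ [] |by move=> u [v sv <-]; exists v].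
rewrite -esumZl ?expR_gt0//.
apply: eq_esum => v _; rewrite -EFinM /wt /pos /= pos_aux_cons -expRD.
by congr (expR _)%:E; ring.
Qed.

Lemma Wn_ge0 xi n w : 0 <= Wn xi n w.
Proof. by apply: esum_ge0 => u _; rewrite lee_fin expR_ge0. Qed.

Lemma measurable_Wn n xi : (forall u k, measurable_fun setT (xi u k)) ->
  measurable_fun setT (Wn xi n).
Proof.
elim: n xi => [|n IH] xi mxi.
  by rewrite (_ : Wn xi 0 = cst 1)//; apply/funext => w; rewrite Wn0.
rewrite (_ : Wn xi n.+1 = fun w => \sum_(0 <= k <oo)
   ((wt (xi [::] k w))%:E * Wn (fun u => xi (k :: u)) n w)); last first.
  by apply/funext => w; rewrite WnS.
apply: ge0_emeasurable_sum => [k w _ _|k _].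
  by rewrite mule_ge0 ?lee_fin ?expR_ge0 ?Wn_ge0.
apply: emeasurable_funM; last exact: IH.
apply/measurable_EFinP; apply: measurableT_comp => //; exact: measurable_wt.
Qed.

End recursion.

(** * Laplace functional of a Poisson process *)

Section counts.
Context (d : measure_display) (T : measurableType d) (R : realType)
  (P : probability T R).
Local Open Scope ereal_scope.

(** The event [D] stands for counts that are already fixed, and [C] for their share in the joint
    law. This generality lets the induction peel off the last count. *)
Lemma integral_prod_counts (N : nat -> T -> \bar R) (G : nat -> \bar R -> \bar R)
    (p g : nat -> nat -> R) (e : nat -> R) :
  (forall i, measurable_fun setT (N i)) ->
  (forall i, measurable_fun setT (G i)) ->
  (forall i y, 0 <= G i y) ->
  (forall i k, G i k%:R%:E = (g i k)%:E) ->
  (forall i k, (0 <= p i k)%R) ->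
  (forall i, \sum_(0 <= k <oo) (p i k * g i k)%:E = (e i)%:E) ->
  (forall i, P (~` \bigcup_k [set w | N i w = k%:R%:E]) = 0) ->
  forall m (D : set T) (C : R), measurable D -> (0 <= C)%R ->
  (forall c : nat -> nat,
     P (D `&` \bigcap_(i < m) [set w | N i w = (c i)%:R%:E]) =
     (C * \prod_(i < m) p i (c i))%:E) ->
  \int[P]_(w in D) \prod_(i < m) G i (N i w) = (C * \prod_(i < m) e i)%:E.
Proof.
move=> mN mG G0 Gg p0 pe Z0; elim=> [|m IH] D C mD C0 DC.
  have := DC (fun=> 0%N); rewrite !big_ord0 mulr1 bigcap_mkord big_ord0 setIT => <-.
  under eq_integral do rewrite big_ord0.
  by rewrite integral_cst// mul1e.
(* [Z] is the null event that the last count is not a natural number; off [Z], the event [D] splits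
   according to that count. *)
pose Z := ~` \bigcup_k [set w | N m w = k%:R%:E].
pose Dk k := D `&` [set w | N m w = k%:R%:E].
have mNk i (c : nat) : measurable [set w | N i w = c%:R%:E].
  rewrite -[X in measurable X]setTI.
  by apply: (mN i _ [set c%:R%:E]) => //; exact: emeasurable_set1.
have mDk k : measurable (Dk k) by exact: measurableI.
have mZ : measurable Z by apply: measurableC; exact: bigcupT_measurable.
have mf n : measurable_fun setT (fun w => \prod_(i < n) G i (N i w)).
  by apply: emeasurable_prod => i; exact: measurableT_comp.
have f0 n w : 0 <= \prod_(i < n) G i (N i w) by apply: prode_ge0.
rewrite (ge0_negligible_integral mZ)//; last 2 first.
- exact: measurable_funTS.
- exact: Z0.
rewrite (_ : D `\` Z = \bigcup_k Dk k); last first.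
  by rewrite setDE setCK setI_bigcupr.
rewrite ge0_integral_bigcup//; last 2 first.
- exact: measurable_funTS.
- by move=> i j _ _ [w [[_ /= Ni] [_ /=]]]; rewrite Ni => -[/eqP]; rewrite eqr_nat => /eqP.
transitivity (\sum_(0 <= k <oo)
   ((C * \prod_(i < m) e i)%:E * (p m k * g m k)%:E)); last first.
  rewrite nneseriesZl; first by rewrite pe -EFinM big_ord_recr/= mulrA.
  move=> k _; rewrite lee_fin mulr_ge0// -lee_fin -Gg//.
apply: eq_eseriesr => k _.
transitivity (\int[P]_(w in Dk k) ((g m k)%:E * \prod_(i < m) G i (N i w))).
  apply: eq_integral => w; rewrite inE => -[_ /= Nmw].
  by rewrite big_ord_recr/= Nmw Gg muleC.
rewrite ge0_integralZl//; last 2 first.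
- exact: measurable_funTS.
- by rewrite -Gg.
rewrite (IH _ (C * p m k)%R)//; last 2 first.
- exact: mulr_ge0.
(* The value [k] of the last count is put back into the configuration, so that the law of [m.+1]
   counts applies. *)
- move=> c; pose c' i := if i == m then k else c i.
  transitivity (P (D `&` \bigcap_(i < m.+1) [set w | N i w = (c' i)%:R%:E])); last first.
    rewrite DC big_ord_recr/= {2}/c' eqxx.
    rewrite (eq_bigr (fun i : 'I_m => p i (c i))); last first.
      by move=> i _; rewrite /c' ltn_eqF.
    by congr EFin; ring.
  congr (P _); apply/seteqP; split => [w [[Dw Nk] Nc]|w [Dw Nc]].
    split=> // i; rewrite /mkset ltnS leq_eqVlt => /predU1P[->|im].
      by rewrite /c' eqxx.
    by rewrite /= /c' ltn_eqF//; exact: Nc.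
  split; first by split => //; have := Nc m (ltnSn m); rewrite /= /c' eqxx.
  by move=> i im; have := Nc i (ltnW im); rewrite /= /c' ltn_eqF.
- by rewrite -!EFinM; congr EFin; ring.
Qed.

Lemma ppmf_ge0 (r : R) k : (0 <= r)%R -> (0 <= ppmf r k)%R.
Proof. by move=> r0; rewrite /ppmf divr_ge0// mulr_ge0 ?expR_ge0 ?exprn_ge0. Qed.

Lemma ppmf_mgf (r a : R) : (0 <= r)%R ->
  \sum_(0 <= k <oo) (ppmf r k * expR (a * k%:R))%:E = (expR (r * (expR a - 1)))%:E.
Proof.
move=> r0.
under eq_eseriesr => k _.
  rewrite (_ : ppmf r k * expR (a * k%:R) = expR (- r) * exp_coeff (r * expR a) k)%R; last first.
    by rewrite /ppmf /exp_coeff/= expRM_natr exprMn; ring.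
  rewrite EFinM; over.
rewrite nneseriesZl; last first.
  by move=> k _; rewrite lee_fin exp_coeff_ge0// mulr_ge0 ?expR_ge0.
rewrite (_ : (r * (expR a - 1) = - r + r * expR a)%R); last by ring.
rewrite expRD EFinM; congr (_ * _).
rewrite /expR -EFin_lim; last exact: is_cvg_series_exp_coeff.
by apply/congr_lim/funext => n /=; rewrite -sumEFin.
Qed.

Lemma ppmf_sum1 (r : R) : (0 <= r)%R -> \sum_(0 <= k <oo) (ppmf r k)%:E = 1.
Proof.
move=> r0; have := ppmf_mgf 0 r0.
rewrite expR0 subrr mulr0 expR0 => <-.
by apply: eq_eseriesr => k _; rewrite mul0r expR0 mulr1.
Qed.

End counts.

Section laplace_functional.
Context (d : measure_display) (T : measurableType d) (R : realType)
  (P : probability T R) (z : nat -> T -> R * R).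
Local Open Scope ereal_scope.
Local Notation mu2 := (@lebesgue_measure R \x @lebesgue_measure R).
Hypothesis zP : lebesgue_PPP P z.

Lemma ppp_measurable k : measurable_fun setT (z k).
Proof. by have [] := zP. Qed.

Lemma ppp_quadrant k w : quadrant (z k w).
Proof. by have [_ []] := zP. Qed.

Lemma measurable_quadrant : measurable (quadrant : set (R * R)).
Proof.
rewrite (_ : quadrant = `]0%R, +oo[ `*` `]0%R, +oo[).
  exact: measurableX.
by apply/seteqP; split => -[x y] /=; rewrite !in_itv/= !andbT.
Qed.

Section simple.
Variables (A : nat -> set (R * R)) (a : nat -> R).
Hypotheses (mA : forall i, measurable (A i)) (Aq : forall i, A i `<=` quadrant).
Hypotheses (Afin : forall i, mu2 (A i) < +oo) (tA : trivIset setT A).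
Hypothesis a0 : forall i, (0 <= a i)%R.

Let N i w := count_in (fun k => z k w) (A i).
Let lam i := fine (mu2 (A i)).

Let lam0 i : (0 <= lam i)%R. Proof. exact: fine_ge0. Qed.

Let lamE i : mu2 (A i) = (lam i)%:E.
Proof. by rewrite fineK// ge0_fin_numE. Qed.

Lemma measurable_count i : measurable_fun setT (N i).
Proof.
apply: ge0_emeasurable_sum => [k w _ _|k _]; first by rewrite lee_fin.
apply/measurable_EFinP; apply: measurableT_comp (ppp_measurable k).
exact: measurable_indic.
Qed.

Lemma ppp_law m (c : nat -> nat) :
  P (\bigcap_(i < m) [set w | N i w = (c i)%:R%:E]) = (\prod_(i < m) ppmf (lam i) (c i))%:E.
Proof.
have [_ [_ /(_ m (fun i => A i) (fun i => c i)) <-]] := zP.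
- congr (P _); apply/seteqP; split => w Nw i.
    by move=> _; exact: (Nw i (ltn_ord i)).
  by move=> im; exact: (Nw (Ordinal im) I).
- by move=> i; split => //; split => //; rewrite /leb2.
- move=> i j ij; apply/eqP/negPn/negP => /set0P/(tA I I) /val_inj ijE.
  by rewrite ijE eqxx in ij.
Qed.

Lemma ppp_law1 i k : P [set w | N i w = k%:R%:E] = (ppmf (lam i) k)%:E.
Proof.
have [_ [_ /(_ 1%N (fun=> A i) (fun=> k))]] := zP.
rewrite big_ord1 => <-.
- congr (P _); apply/seteqP; split => w Nw => [j _//|].
  exact: (Nw ord0).
- by move=> j; split => //; split => //; rewrite /leb2.
- by move=> j j'; rewrite !ord1.
Qed.

(** The Poisson masses add up to 1, which leaves no probability for an infinite count. *)
Lemma count_nat i : P (~` \bigcup_k [set w | N i w = k%:R%:E]) = 0.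
Proof.
have mNk (c : nat) : measurable [set w | N i w = c%:R%:E].
  rewrite -[X in measurable X]setTI.
  by apply: (@measurable_count i _ [set c%:R%:E]) => //; exact: emeasurable_set1.
rewrite probability_setC; last exact: bigcupT_measurable.
suff -> : P (\bigcup_k [set w | N i w = k%:R%:E]) = 1 by rewrite subee.
rewrite -(ppmf_sum1 (lam0 i)) measure_bigcup//; last first.
  by move=> j k _ _ [w [/= ->]] [/eqP]; rewrite eqr_nat => /eqP.
rewrite (@eq_eseriesl _ _ predT); last by move=> k; rewrite in_setT.
by apply: eq_eseriesr => k _; exact: ppp_law1.
Qed.

Lemma ppp_counts_mgf m :
  \int[P]_w \prod_(i < m) expeR ((a i)%:E * N i w) =
  (\prod_(i < m) expR (lam i * (expR (a i) - 1)))%:E.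
Proof.
rewrite (@integral_prod_counts _ _ _ P N (fun i y => expeR ((a i)%:E * y))
  (fun i => ppmf (lam i)) (fun i k => expR (a i * k%:R))
  (fun i => expR (lam i * (expR (a i) - 1))) _ _ _ _ _ _ _ m setT 1%R) ?mul1r//.
- exact: measurable_count.
- move=> i; apply: measurableT_comp; first exact: measurable_expeR.
  exact: measurable_funeM.
- by move=> i y; exact: expeR_ge0.
- by move=> i k; exact: ppmf_ge0.
- by move=> i; exact: ppmf_mgf.
- exact: count_nat.
- by move=> c; rewrite setTI mul1r ppp_law.
Qed.

Let g m x := (\sum_(i < m) a i * \1_(A i) x)%R.

(** The sets are disjoint, so at most one summand is nonzero at [x]. *)
Lemma expR_simple m x :
  (expR (g m x) - 1 = \sum_(i < m) (expR (a i) - 1) * \1_(A i) x)%R.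
Proof.
rewrite /g; have [[j Aj]|nA] := pselect (exists i : 'I_m, A i x).
- have nAi (i : 'I_m) : i != j -> (\1_(A i) x = 0 :> R)%R.
    move=> ij; rewrite indicE; case: (boolP (x \in A i)) => //; rewrite inE => Ai.
    have /val_inj ijE : val i = val j by apply: (tA I I); exists x.
    by rewrite ijE eqxx in ij.
  have Aj1 : (\1_(A j) x = 1 :> R)%R by rewrite indicE mem_set.
  rewrite (bigD1 j)//= [in RHS](bigD1 j)//= Aj1 !mulr1 !big1 ?addr0// => i ij.
    by rewrite nAi// mulr0.
  by rewrite nAi// mulr0.
- have nAi (i : 'I_m) : (\1_(A i) x = 0 :> R)%R.
    by rewrite indicE memNset// => Ai; apply: nA; exists i.
  rewrite !big1 ?expR0 ?subrr// => i _; by rewrite nAi// mulr0.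
Qed.

(** Summed over the atoms, a simple function is a linear combination of counts, which are
    independent Poisson variables. *)
Lemma ppp_simple m :
  \int[P]_w expeR (\sum_(0 <= k <oo) (g m (z k w))%:E) =
  expeR (\int[mu2]_(x in quadrant) (expR (g m x) - 1)%:E).
Proof.
transitivity (\int[P]_w \prod_(i < m) expeR ((a i)%:E * N i w)).
  apply: eq_integral => w _; rewrite -expeR_sum; congr expeR.
  under eq_eseriesr do rewrite /g -sumEFin.
  rewrite nneseries_sum; last by move=> i j _; rewrite lee_fin mulr_ge0.
  by apply: eq_bigr => i _; rewrite /N /count_in -nneseriesZl.
rewrite ppp_counts_mgf.
transitivity (expeR (\sum_(i < m) (lam i * (expR (a i) - 1))%:E)).
  by rewrite expeR_sum -prodEFin.
congr expeR.
have ea i : (0 <= expR (a i) - 1)%R by rewrite subr_ge0 -expR0 ler_expR.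
under [RHS]eq_integral do rewrite expR_simple -sumEFin.
rewrite ge0_integral_sum//; last 3 first.
- exact: measurable_quadrant.
- move=> i; apply/measurable_EFinP; apply: measurable_funM; first exact: measurable_cst.
  exact: measurable_indic (mA i).
- by move=> i x _; rewrite lee_fin mulr_ge0.
apply: eq_bigr => i _; under eq_integral do rewrite EFinM.
rewrite ge0_integralZl//; last 3 first.
- exact: measurable_quadrant.
- by apply/measurable_EFinP; exact: measurable_indic (mA i).
- by rewrite lee_fin.
rewrite integral_indic//; last 2 first.
- exact: measurable_quadrant.
- exact: mA.
by rewrite setIidl// [LHS]EFinM muleC -lamE.
Qed.

End simple.

Import HBNNSimple.

Lemma nnsfun_decomp (g : {nnsfun (R * R)%type >-> R}) (B : set (R * R)) : measurable B ->
  exists m (a : nat -> R) (A : nat -> set (R * R)),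
  [/\ forall i, (0 <= a i)%R, forall i, measurable (A i), forall i, A i `<=` B,
   trivIset setT A & forall x, (g x * \1_B x = \sum_(i < m) a i * \1_(A i) x)%R].
Proof.
move=> mB; pose s := finmap.enum_fset (fset_set (range g)).
have us : uniq s by exact: finmap.fset_uniq.
(* Past the last value the sets are empty. [Num.max] makes every coefficient nonnegative by
   construction and changes none of the actual values of [g]. *)
exists (size s), (fun i => Num.max 0%R (nth 0%R s i)),
  (fun i => if (i < size s)%N then g @^-1` [set nth 0%R s i] `&` B else set0).
split.
- by move=> i; rewrite le_max lexx.
- move=> i; case: ifP => // _; exact: measurableI.
- by move=> i; case: ifP => // _ x [].
- move=> i j _ _ [x []]; case: ifP => // si; case: ifP => // sj [/= gi _] [/= gj _].
  by apply/eqP; rewrite -(nth_uniq 0%R si sj us) -gi -gj.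
- move=> x; rewrite fimfunE fsbig_finite//= -/s (big_nth 0%R) big_mkord mulr_suml.
  apply: eq_bigr => i _; rewrite ltn_ord.
  have si0 : (0 <= nth 0%R s i)%R.
    have : nth 0%R s i \in s by rewrite mem_nth.
    by rewrite in_fset_set// inE => -[y _ <-].
  by rewrite max_r// indicI -mulrA.
Qed.

(* Campbell's formula. *)
Lemma ppp_laplace (f : R * R -> \bar R) : measurable_fun setT f ->
  (forall x, 0 <= f x) ->
  \int[P]_w expeR (\sum_(0 <= k <oo) f (z k w)) =
  expeR (\int[mu2]_(x in quadrant) (expeR (f x) - 1)).
Proof.
move=> mf f0.
pose g := nnsfun_approx measurableT mf.
(* The Poisson law is given for sets of finite measure only, so the simple approximations are cut
   off to boxes that increase to the quadrant. *)
pose I0 (n : nat) : set R := `]0%R, n%:R]%classic.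
have I0fin n : lebesgue_measure (I0 n) \is a fin_num.
  by rewrite /I0 lebesgue_measure_itv/=; case: ifP.
pose B (n : nat) : set (R * R) := I0 n `*` I0 n.
have mB n : measurable (B n) by apply: measurableX; exact: measurable_itv.
have Bq n : B n `<=` quadrant.
  by move=> [x y] [] /=; rewrite /I0 /= !in_itv/= => /andP[? _] /andP[? _].
pose h n x := (g n x * \1_(B n) x)%R.
have h0 n x : (0 <= h n x)%R by rewrite mulr_ge0.
have mh n : measurable_fun setT (h n).
  by apply: measurable_funM => //; exact: measurable_indic.
have ndh x : {homo (fun n => h n x) : m n / (m <= n)%N >-> (m <= n)%R}.
  move=> m n mn; apply: ler_pM => //; first exact/lefP/nd_nnsfun_approx.
  rewrite !indicE ler_nat; have [xB|//] := boolP (x \in B m).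
  rewrite (_ : x \in B n)//; move: xB; rewrite !inE /B /I0 /= !in_itv/=.
  have mnR : (m%:R <= n%:R :> R)%R by rewrite ler_nat.
  move=> [/andP[-> x1] /andP[-> x2]]; split; exact: le_trans mnR.
have hf x : quadrant x -> (h n x)%:E @[n --> \oo] --> f x.
  move=> [x1 x2].
  apply: cvg_trans (cvg_nnsfun_approx measurableT mf (fun x _ => f0 x) (I : setT x)).
  apply: near_eq_cvg; near=> n; rewrite /h /= indicE mem_set ?mulr1//.
  split; rewrite /I0 /= in_itv/= ?x1 ?x2/=; near: n; exact: nbhs_infty_ger.
have step n : \int[P]_w expeR (\sum_(0 <= k <oo) (h n (z k w))%:E) =
    expeR (\int[mu2]_(x in quadrant) (expR (h n x) - 1)%:E).
  have [m [a [A [a0 mA AB tA hE]]]] := nnsfun_decomp (g n) (mB n).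
  have Afin i : mu2 (A i) < +oo.
    apply: (@le_lt_trans _ _ (mu2 (B n))); first by
      apply: (@le_measure _ _ _ mu2 (A i) (B n)); rewrite ?inE;
      [exact: mA|exact: mB|exact: AB].
    rewrite product_measure1E; [|exact: measurable_itv..].
    apply: lte_mul_pinfty => //; first exact: I0fin.
    by have := I0fin n; rewrite fin_numElt => /andP[].
  have Aq i : A i `<=` quadrant by apply: subset_trans (AB i) (Bq n).
  rewrite (_ : h n = fun x => \sum_(i < m) a i * \1_(A i) x)%R; last first.
    by apply/funext => x; rewrite /h hE.
  exact: ppp_simple.
have hlim k w : limn (fun n => (h n (z k w))%:E) = f (z k w).
  by apply/cvg_lim => //; apply: hf; exact: ppp_quadrant.
have mS (u : R * R -> \bar R) : measurable_fun setT u -> (forall x, 0 <= u x) ->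
    measurable_fun setT (fun w => expeR (\sum_(0 <= k <oo) u (z k w))).
  move=> mu u0; apply: measurableT_comp; first exact: measurable_expeR.
  apply: ge0_emeasurable_sum => // k _.
  by apply: measurableT_comp => //; exact: ppp_measurable.
have ndS w : {homo (fun n => \sum_(0 <= k <oo) (h n (z k w))%:E) : m n / (m <= n)%N >-> m <= n}.
  move=> m n mn; apply: lee_nneseries => k _; first by rewrite lee_fin.
  by rewrite lee_fin; exact: ndh.
(* Two monotone limits are exchanged, one with the expectation and one with the sum over the
   atoms. *)
transitivity (limn (fun n => \int[P]_w expeR (\sum_(0 <= k <oo) (h n (z k w))%:E))).
  rewrite -monotone_convergence//; last 3 first.
  - by move=> n; apply: (mS (EFin \o h n)) => // [|x]; [exact/measurable_EFinP|rewrite lee_fin].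
  - by move=> n w _; exact: expeR_ge0.
  - by move=> w _ m n mn; rewrite lee_expeR; exact: ndS.
  apply: eq_integral => w _; apply/esym/cvg_lim => //.
  apply: cvg_expeR.
    by rewrite (lt_le_trans _ (nneseries_ge0 _)).
  under eq_eseriesr do rewrite -hlim.
  rewrite -lim_nneseries_nd; last 2 first.
  - by move=> n k; rewrite lee_fin.
  - by move=> k m n mn; rewrite lee_fin; exact: ndh.
  exact: ereal_nondecreasing_is_cvgn.
rewrite (_ : (fun n => \int[P]_w _) =
    fun n => expeR (\int[mu2]_(x in quadrant) (expR (h n x) - 1)%:E)); last first.
  by apply/funext => n; rewrite step.
have eh0 n x : (0 <= expR (h n x) - 1)%R by rewrite subr_ge0 -expR0 ler_expR.
apply/cvg_lim => //; apply: cvg_expeR.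
  rewrite (lt_le_trans _ (integral_ge0 _ _))// => x _.
  by rewrite sube_ge0 ?expeR_ge1.
rewrite (_ : \int[mu2]_(x in quadrant) (expeR (f x) - 1) =
   \int[mu2]_(x in quadrant) limn (fun n => (expR (h n x) - 1)%:E)); last first.
  apply: eq_integral => x; rewrite inE => qx; apply/esym/cvg_lim => //.
  under eq_fun do rewrite EFinB.
  apply: cvgeB => //.
  - by rewrite fin_num_adde_defl.
  - apply: (@cvg_expeR _ (fun n => (h n x)%:E)); last exact: hf.
    by rewrite (lt_le_trans _ (f0 x)).
  - exact: cvg_cst.
apply: cvg_monotone_convergence => //.
- exact: measurable_quadrant.
- move=> n; apply/measurable_EFinP; apply: measurable_funTS.
  apply: measurable_funB; last exact: measurable_cst.
  apply: measurableT_comp; [exact: measurable_expR|exact: mh].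
- by move=> n x _; rewrite lee_fin.
- by move=> x _ m n mn; rewrite lee_fin lerB// ler_expR; exact: ndh.
Unshelve. all: by end_near. Qed.

End laplace_functional.

(** * Recursion for the moment generating functions *)

Section laplace_recursion.
Context (R : realType).
Local Open Scope ereal_scope.
Local Notation mu2 := (@lebesgue_measure R \x @lebesgue_measure R).

(* The absolute value makes [1 <= phi n s] hold for all [s]; only [0 <= s]
   matters, where [phi n s] is the expectation of [expR (s * Wn n)]. *)
Fixpoint phi (n : nat) (s : R) : \bar R :=
  if n is m.+1 then expeR (\int[mu2]_(x in quadrant) (phi m (s * wt x)%R - 1))
  else (expR `|s|)%:E.

Lemma phiS n s :
  phi n.+1 s = expeR (\int[mu2]_(x in quadrant) (phi n (s * wt x)%R - 1)).
Proof. by []. Qed.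

Lemma phi_ge1 n s : 1 <= phi n s.
Proof.
elim: n s => [s|n IH s]; first by rewrite lee_fin -expR0 ler_expR.
rewrite phiS.
by apply: expeR_ge1; apply: integral_ge0 => x _; rewrite sube_ge0.
Qed.

Lemma measurable_phi n : measurable_fun setT (phi n).
Proof.
elim: n => [|n IH].
  apply/measurable_EFinP; apply: measurableT_comp => //; exact: measurable_normr.
(* The parameter [s] becomes a third coordinate; Tonelli's measurability of partial integrals is
   then used once for each spatial variable. *)
pose f (y : R * R * R) := (phi n (y.1.1 * wt (y.1.2, y.2))%R - 1) *
  (\1_(quadrant : set (R * R)) (y.1.2, y.2))%:E.
have f0 y : 0 <= f y by rewrite mule_ge0 ?lee_fin// sube_ge0// phi_ge1.
have mi : measurable_fun setT (\1_(quadrant : set (R * R)) : R * R -> R).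
  exact: measurable_indic (@measurable_quadrant R).
have mp : measurable_fun setT (fun y : R * R * R => (y.1.2, y.2)).
  by apply: measurable_fun_pair => //; exact: measurableT_comp.
have mf : measurable_fun setT f.
  apply: emeasurable_funM; last first.
    apply/measurable_EFinP; exact: (measurableT_comp mi mp).
  apply: emeasurable_funB; last exact: measurable_cst.
  apply: measurableT_comp => //; apply: measurable_funM => //.
    exact: measurableT_comp.
  by apply: measurableT_comp => //; exact: measurable_wt.
pose l : {sigma_finite_measure set (measurableTypeR R) -> \bar R} := @lebesgue_measure R.
have m1 := @measurable_fun_fubini_tonelli_F _ _ _ _ R l f mf f0.
have m10 y : 0 <= fubini_F l f y by exact: integral_ge0.
have -> : phi n.+1 = expeR \o fubini_F l (fubini_F l f).
  apply/funext => s; rewrite phiS integral_mkcond epatch_indic; congr expeR.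
  rewrite fubini_tonelli1//.
  - apply: emeasurable_funM; last first.
      by apply/measurable_EFinP; exact: mi.
    apply: emeasurable_funB; last exact: measurable_cst.
    apply: measurableT_comp => //; apply: measurable_funM => //.
    exact: measurable_wt.
  - by move=> x; rewrite mule_ge0 ?lee_fin// sube_ge0// phi_ge1.
apply: measurableT_comp; first exact: measurable_expeR.
exact: (@measurable_fun_fubini_tonelli_F _ _ _ _ R l _ m1 m10).
Qed.

Context (d : measure_display) (T : measurableType d) (P : probability T R).

(** All factors are at least 1, so the partial products increase. This reduces infinitely many
    children to finitely many. *)
Lemma integral_expeR_nneseries (b : nat -> T -> \bar R) :
  (forall k, measurable_fun setT (b k)) -> (forall k w, 0 <= b k w) ->
  \int[P]_w expeR (\sum_(0 <= k <oo) b k w) =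
  limn (fun m => \int[P]_w \prod_(i < m) expeR (b i w)).
Proof.
move=> mb b0.
rewrite -monotone_convergence//.
- apply: eq_integral => w _; apply/esym/cvg_lim => //.
  by apply: expeR_nneseries => n; exact: b0.
- move=> m; apply: emeasurable_prod => i.
  by apply: measurableT_comp => //; exact: measurable_expeR.
- by move=> m w _; apply: prode_ge0 => i _; exact: expeR_ge0.
- move=> w _; apply/nondecreasing_seqP => m.
  rewrite big_ord_recr/= -[X in X <= _]mule1; apply: lee_pmul => //.
    by apply: prode_ge0 => i _; exact: expeR_ge0.
  exact: expeR_ge1.
Qed.

Definition branching (xi : seq nat -> nat -> T -> R * R) :=
  (forall u, lebesgue_PPP P (xi u)) /\ mutually_indep P xi.

Lemma branching_shift xi k : branching xi -> branching (fun u => xi (k :: u)).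
Proof.
move=> [xiP ixi]; split => [u|m u E uinj Em]; first exact: xiP.
by apply: (ixi m (fun i => k :: u i)) => // i j [/uinj].
Qed.

Lemma branching_measurable xi : branching xi -> forall u k, measurable_fun setT (xi u k).
Proof. by move=> [xiP _] u k; exact: ppp_measurable (xiP u) k. Qed.

(** * Averaging over the subtrees of the first generation *)

Section offspring.
Variables (xi : seq nat -> nat -> T -> R * R) (n : nat) (s : R).
Hypotheses (Bxi : branching xi) (s0 : (0 <= s)%R).
Let X k := Wn (fun u => xi (k :: u)) n.
Let a k w := (s * wt (xi [::] k w))%R.
Hypothesis IH : forall k r, (0 <= r)%R -> \int[P]_w expeR (r%:E * X k w) = phi n r.

(** Hybrid factors: the subtrees of the children before [j] have been averaged, the others not yet.
    Moving [j] from 0 to [m] averages them all. *)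
Let f j i w := if (i < j)%N then phi n (a i w) else expeR ((a i w)%:E * X i w).

Let a0 k w : (0 <= a k w)%R. Proof. by rewrite mulr_ge0 ?expR_ge0. Qed.

Let mxi := branching_measurable Bxi.

Let swap m (j : 'I_m) :
  \int[P]_w \prod_(i < m) f j i w = \int[P]_w \prod_(i < m) f j.+1 i w.
Proof.
(* [S] is the subtree of child [j]. [X j] depends on displacements in [S] only; all else, including
   the displacement of child [j] from the root, is determined outside [S]. *)
pose S := [set u : seq nat | exists v, u = val j :: v].
pose B (i : 'I_m) w := if i == j then 1 else f j i w.
have B0 i w : 0 <= B i w.
  rewrite /B /f; case: ifP => // _; case: ifP => _; last exact: expeR_ge0.
  by rewrite (le_trans _ (phi_ge1 _ _)).
have BE i w : i != j -> B i w = f j i w by rewrite /B => /negbTE ->.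
pose S1 := g_sigma_algebraType (cyl xi (~` S)).
pose S2 := g_sigma_algebraType (cyl xi S).
pose G (y : S1 * S2) := \prod_(i < m) B i y.1 * expeR ((a j y.1)%:E * X j y.2).
have ma i : measurable_fun setT (a i : S1 -> R).
  apply: measurable_funM => //; apply: measurableT_comp; first exact: measurable_wt.
  by apply: measurable_xi_cyl => -[v].
have mX2 : measurable_fun setT (X j : S2 -> \bar R).
  apply: measurable_Wn => u k; apply: measurable_xi_cyl; by exists u.
have mB i : measurable_fun setT (B i : S1 -> \bar R).
  have [->|ij] := eqVneq i j.
    by rewrite (_ : B j = cst 1)//; apply/funext => w; rewrite /B eqxx.
  rewrite (_ : B i = f j i); last by apply/funext => w; exact: BE.
  rewrite /f; case: (i < j)%N.
    by apply: measurableT_comp; [exact: measurable_phi|exact: ma].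
  apply: measurableT_comp; first exact: measurable_expeR.
  apply: emeasurable_funM; first by apply/measurable_EFinP; exact: ma.
  apply: measurable_Wn => u k; apply: measurable_xi_cyl => -[v [ijE]].
  by move: ij; rewrite -(inj_eq val_inj) /= ijE eqxx.
have mG : measurable_fun setT G.
  apply: emeasurable_funM.
    apply: emeasurable_prod => i.
    by apply: measurableT_comp; [exact: mB|exact: measurable_fst].
  apply: measurableT_comp; first exact: measurable_expeR.
  apply: emeasurable_funM.
    apply/measurable_EFinP.
    by apply: measurableT_comp; [exact: ma|exact: measurable_fst].
  by apply: measurableT_comp; [exact: mX2|exact: measurable_snd].
have G0 y : 0 <= G y by rewrite mule_ge0 ?expeR_ge0// prode_ge0.
have Bprod w : \prod_(i < m) B i w = \prod_(i < m | i != j) f j i w.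
  rewrite (bigD1 j)//= {1}/B eqxx mul1e.
  by apply: eq_bigr => i /BE.
transitivity (\int[P]_w G (w, w)).
  apply: eq_integral => w _; rewrite /G Bprod (bigD1 j)//= muleC.
  by congr (_ * _); rewrite /f ltnn.
rewrite (branching_fubini (P := P) mxi)//; last by have [] := Bxi.
apply: eq_integral => w _; rewrite /G /= ge0_integralZl//; last 3 first.
- apply: measurableT_comp; first exact: measurable_expeR.
  apply: emeasurable_funM; first exact: measurable_cst.
  by apply: measurable_Wn => u k; exact: mxi.
- by move=> w' _; exact: expeR_ge0.
- exact: prode_ge0.
rewrite IH// Bprod [RHS](bigD1 j)//= muleC /f ltnS leqnn; congr (_ * _).
by apply: eq_bigr => i ij; rewrite ltnS [in RHS]leq_eqVlt (inj_eq val_inj) (negbTE ij).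
Qed.

Let swap_all m : \int[P]_w \prod_(i < m) expeR ((a i w)%:E * X i w) =
  \int[P]_w \prod_(i < m) phi n (a i w).
Proof.
have step j : (j <= m)%N ->
    \int[P]_w \prod_(i < m) f 0 i w = \int[P]_w \prod_(i < m) f j i w.
  by elim: j => // j IHj jm; rewrite IHj ?(ltnW jm)// (swap (Ordinal jm)).
have := step m (leqnn m); rewrite /f => ->.
by apply: eq_integral => w _; apply: eq_bigr => i _; rewrite ltn_ord.
Qed.

Lemma offspring_step : \int[P]_w expeR (s%:E * Wn xi n.+1 w) = phi n.+1 s.
Proof.
have X0 k w : 0 <= X k w by exact: Wn_ge0.
transitivity (\int[P]_w expeR (\sum_(0 <= k <oo) ((a k w)%:E * X k w))).
  apply: eq_integral => w _; rewrite WnS -nneseriesZl//; last first.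
    by move=> k _; rewrite mule_ge0 ?lee_fin ?expR_ge0 ?Wn_ge0.
  by under eq_eseriesr do rewrite muleA -EFinM.
rewrite integral_expeR_nneseries; last 2 first.
- move=> k; apply: emeasurable_funM; last first.
    by apply: measurable_Wn => u j; exact: mxi.
  apply/measurable_EFinP; apply: measurable_funM => //.
  by apply: measurableT_comp; [exact: measurable_wt|exact: mxi].
- by move=> k w; rewrite mule_ge0// lee_fin.
(* Written as the exponential of its logarithm, which is nonnegative since [phi n] is at least 1,
   the averaged product becomes again the exponential of a sum over atoms, as [ppp_laplace]
   requires. *)
rewrite (_ : (fun m => _) = fun m => \int[P]_w \prod_(i < m)
    expeR (lne (phi n (a i w)))); last first.
  apply/funext => m; rewrite swap_all; apply: eq_integral => w _.
  by apply: eq_bigr => i _; rewrite lne_expeR_ge1// phi_ge1.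
have ml : measurable_fun setT (fun x : R * R => lne (phi n (s * wt x))).
  apply: measurableT_comp; first exact: measurable_lne.
  apply: measurableT_comp; first exact: measurable_phi.
  by apply: measurable_funM => //; exact: measurable_wt.
have l0 x : 0 <= lne (phi n (s * wt x)) by rewrite lne_ge0 phi_ge1.
rewrite -(@integral_expeR_nneseries (fun k w => lne (phi n (a k w)))); last 2 first.
- by move=> k; apply: (measurableT_comp ml); exact: mxi.
- by move=> k w; exact: l0.
have [/(_ [::]) xiP _] := Bxi.
rewrite (ppp_laplace xiP ml l0) phiS; congr expeR.
by apply: eq_integral => x _; rewrite lne_expeR_ge1// phi_ge1.
Qed.

End offspring.

Lemma expeR_Wn_mean n xi s : branching xi -> (0 <= s)%R ->
  \int[P]_w expeR (s%:E * Wn xi n w) = phi n s.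
Proof.
elim: n xi s => [|n IH] xi s Bxi s0.
  under eq_integral do rewrite Wn0 mule1.
  by rewrite integral_cst// [X in _ * X]probability_setT mule1 /= ger0_norm.
apply: offspring_step => // k r r0; apply: IH => //; exact: branching_shift.
Qed.

End laplace_recursion.

(** * The explosive solution *)

Section exponential_inequalities.
Context (R : realType).
Implicit Types x y u : R.

Lemma monotone_of_derive (f df : R -> R) (a b : R) : a <= b ->
  (forall x, a <= x -> is_derive x 1 f (df x)) ->
  (forall x, a <= x -> 0 <= df x) -> f a <= f b.
Proof.
move=> ab fdf df0.
have [x|c cab|c /itvP cab fE] := @MVT_segment R f df a b ab.
- by rewrite in_itv/= => /andP[/ltW ax _]; exact: fdf.
- apply: derivable_within_continuous => x; rewrite in_itv/= => /andP[ax _].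
  by have [] := fdf x ax.
rewrite -subr_ge0 fE mulr_ge0 ?subr_ge0//; apply: df0; by rewrite cab.
Qed.

(* The first integral of [g'' = expR g - 1] is [g' ^+ 2 = kin2 g]. *)
Definition kin2 (x : R) : R := 2 * (expR x - x - 1).

Lemma is_derive_kin2 x : is_derive x 1 kin2 (2 * (expR x - 1)).
Proof. by apply: is_derive_eq; rewrite subr0. Qed.

Lemma expR_taylor x n : 0 <= x -> \sum_(k < n) x ^+ k / k`!%:R <= expR x.
Proof.
move=> x0; rewrite /expR.
rewrite (_ : \sum_(k < n) _ = series (exp_coeff x) n); last first.
  by rewrite /series/= big_mkord.
apply: nondecreasing_cvgn_le; last exact: is_cvg_series_exp_coeff.
by apply: nondecreasing_series => k _ _; exact: exp_coeff_ge0.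
Qed.

Lemma kin2_ge_sqr x : 0 <= x -> x ^+ 2 <= kin2 x.
Proof.
move=> x0; have := expR_taylor 3 x0.
rewrite !big_ord_recr big_ord0 /= /kin2 !factS fact0 expr0 expr1.
lra.
Qed.

(** The degree 4 term of the series already gives [x ^+ 4 / 12]. The constant 16 makes the bound a
    square, whose root makes [slow] integrable at infinity. *)
Lemma kin2_ge_quartic x : 0 <= x -> (x ^+ 2 / 4) ^+ 2 <= kin2 x.
Proof.
move=> x0; have := expR_taylor 5 x0.
rewrite !big_ord_recr big_ord0 /= /kin2 !factS fact0 expr0 expr1.
have := exprn_ge0 2 x0; have := exprn_ge0 3 x0; have := exprn_ge0 4 x0.
rewrite expr_div_n -exprM.
lra.
Qed.

(** The difference vanishes at 0 and has a nonnegative derivative. The square root of this bound,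
    [kin_le], controls [x^-1 - slow x] near 0. *)
Lemma kin2_le x : 0 <= x -> kin2 x <= x ^+ 2 * expR x.
Proof.
move=> x0; rewrite -subr_ge0.
pose f y := y ^+ 2 * expR y - kin2 y.
have -> : 0 = f 0 by rewrite /f /kin2 expR0; lra.
apply: (@monotone_of_derive f
  (fun y => y ^+ 2 * expR y + 2 * (y * expR y - expR y + 1))) => // y y0.
  have := is_derive_kin2 y => ?.
  apply: is_derive_eq; rewrite /GRing.scale/=; lra.
apply: addr_ge0; first by rewrite mulr_ge0 ?sqr_ge0 ?expR_ge0.
rewrite mulr_ge0//.
have := expR_ge1Dx (- y).
rewrite -(ler_pM2l (expR_gt0 y)) -expRD subrr expR0.
lra.
Qed.

Lemma kin2_gt0 x : 0 < x -> 0 < kin2 x.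
Proof. by move=> x0; rewrite (lt_le_trans _ (kin2_ge_sqr (ltW x0)))// exprn_gt0. Qed.

Definition kin (x : R) : R := Num.sqrt (kin2 x).

Lemma kin_gt0 x : 0 < x -> 0 < kin x.
Proof. by move=> x0; rewrite sqrtr_gt0 kin2_gt0. Qed.

Lemma kin_ge x : 0 <= x -> x <= kin x.
Proof.
move=> x0; rewrite -[leLHS]ger0_norm// -sqrtr_sqr ler_sqrt ?kin2_ge_sqr//.
by rewrite (le_trans _ (kin2_ge_sqr x0)) ?sqr_ge0.
Qed.

Lemma kin_ge_sqr x : 0 <= x -> x ^+ 2 / 4 <= kin x.
Proof.
move=> x0; have q0 : 0 <= x ^+ 2 / 4 by rewrite divr_ge0 ?sqr_ge0.
rewrite -[leLHS]ger0_norm// -sqrtr_sqr ler_sqrt ?kin2_ge_quartic//.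
by rewrite (le_trans _ (kin2_ge_sqr x0)) ?sqr_ge0.
Qed.

Lemma kin_le x : 0 <= x -> kin x <= x * expR (x / 2).
Proof.
move=> x0; have e0 : 0 <= x * expR (x / 2) by rewrite mulr_ge0 ?expR_ge0.
rewrite -[leRHS]ger0_norm// -sqrtr_sqr ler_sqrt ?sqr_ge0//.
rewrite exprMn -expRM_natl [2%:R * _]mulrC divfK//.
exact: kin2_le.
Qed.

Lemma is_derive_kin x : 0 < x -> is_derive x 1 kin ((expR x - 1) / kin x).
Proof.
move=> x0; have h1 := is_derive_kin2 x.
have h2 := is_derive1_sqrt (kin2_gt0 x0).
have -> : (expR x - 1) / kin x = (2 * Num.sqrt (kin2 x))^-1 * (2 * (expR x - 1)).
  rewrite /kin invfM; set s := Num.sqrt _; field.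
  by rewrite /s gt_eqF// (kin_gt0 x0).
exact: is_derive1_comp.
Qed.

Lemma continuous_kin x : 0 < x -> {for x, continuous kin}.
Proof.
move=> x0; apply: differentiable_continuous; apply/derivable1_diffP.
by have [] := is_derive_kin x0.
Qed.

(** Along a solution of g' = [kin] g, the time spent per unit of height. *)
Definition slow (x : R) : R := (kin x)^-1.

Lemma slow_gt0 x : 0 < x -> 0 < slow x.
Proof. by move=> x0; rewrite invr_gt0 kin_gt0. Qed.

Lemma continuous_slow x : 0 < x -> {for x, continuous slow}.
Proof.
by move=> x0; apply: continuousV; [rewrite gt_eqF ?kin_gt0|exact: continuous_kin].
Qed.

Lemma slow_le x : 0 < x -> slow x <= x^-1.
Proof. by move=> x0; rewrite lef_pV2 ?posrE ?kin_gt0// kin_ge// ltW. Qed.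

Lemma slow_le_sqr x : 0 < x -> slow x <= 4 * x ^- 2.
Proof.
move=> x0; have q0 : 0 < x ^+ 2 / 4 by rewrite divr_gt0 ?exprn_gt0.
rewrite (_ : 4 * x ^- 2 = (x ^+ 2 / 4)^-1); last by rewrite invf_div.
by rewrite lef_pV2 ?posrE ?kin_gt0// kin_ge_sqr// ltW.
Qed.

(** By [kin_le], [slow x] is at least [x^-1 * expR (- (x / 2))], and the exponential is at least
    [1 - x / 2]. This bounded error is what makes the regularised integral converge at 0. *)
Lemma slow_ge x : 0 < x -> x^-1 - 2^-1 <= slow x.
Proof.
move=> x0; have : (x * expR (x / 2))^-1 <= slow x.
  by rewrite lef_pV2 ?posrE ?kin_gt0 ?mulr_gt0 ?expR_gt0// kin_le// ltW.
apply: le_trans; rewrite invfM -expRN.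
have := expR_ge1Dx (- (x / 2)).
rewrite -(ler_pM2l (_ : 0 < x^-1)) ?invr_gt0//; apply: le_trans.
rewrite mulrDr mulr1 mulrN mulrA mulVf ?gt_eqF//.
by rewrite mul1r.
Qed.

End exponential_inequalities.

(** * The time needed to reach infinity *)

Section explosion_time.
Context (R : realType).
Implicit Types x y u v : R.
Local Notation leb := (@lebesgue_measure R).

Lemma measurable_slow (D : set R) : D `<=` `]0, +oo[ -> measurable D ->
  measurable_fun D (@slow R).
Proof.
move=> D0 mD; apply: (measurable_funS _ D0) => //.
apply: open_continuous_measurable_fun => // x.
by rewrite inE/= in_itv/= andbT; exact: continuous_slow.
Qed.

Lemma itv_gt0 x : 0 < x -> `[x, +oo[%classic `<=` (`]0, +oo[%classic : set R).
Proof.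
by move=> x0 u /=; rewrite !in_itv/= !andbT; exact: lt_le_trans.
Qed.

Lemma continuous_invsqr u : 0 < u -> {for u, continuous (fun u : R => 4 * u ^- 2)}.
Proof.
move=> u0; rewrite /prop_for /continuous_at; apply: cvgM; first exact: cvg_cst.
apply: cvgV; first by rewrite expf_neq0// gt_eqF.
exact: exprn_continuous.
Qed.

Lemma integral_invsqr x : 0 < x ->
  (\int[leb]_(u in `[x, +oo[) (4 * u ^- 2)%:E = (4 * x^-1)%:E)%E.
Proof.
move=> x0.
have dF u : 0 < u -> is_derive u 1 (fun u => - 4 * u^-1) (4 * u ^- 2).
  move=> u0; have h : is_derive u 1 (fun y : R => y^-1) (- u ^- 2 *: 1).
    by apply: is_deriveV; rewrite gt_eqF.
  have h2 := @is_deriveZ _ _ _ (fun y : R => y^-1) (- 4) u 1 _ h.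
  apply: (is_derive_eq h2); rewrite /GRing.scale/= mulr1; lra.
rewrite (@ge0_continuous_FTC2y _ (fun u => 4 * u ^- 2) (fun u => - 4 * u^-1) x 0).
- by rewrite sub0e -EFinN mulNr opprK.
- by move=> u xu; rewrite mulr_ge0// invr_ge0 exprn_ge0// ltW// (lt_le_trans x0).
- apply: continuous_in_subspaceT => u; rewrite inE/= in_itv/= andbT => xu.
  exact/continuous_invsqr/(lt_le_trans x0 xu).
- rewrite -(mulr0 (- 4)); apply: cvgM; first exact: cvg_cst.
  apply/gtr0_cvgV0; last exact: cvg_id.
  by near=> u; near: u; exact: nbhs_pinfty_gt.
- by move=> u xu; have [] := dF u (lt_trans x0 xu).
- apply: cvg_at_right_filter; apply: cvgM; first exact: cvg_cst.
  by apply: inv_continuous; rewrite gt_eqF.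
- move=> u; rewrite in_itv/= andbT => xu.
  by rewrite derive1E; have [_ ->] := dF u (lt_trans x0 xu).
Unshelve. all: by end_near. Qed.

(** The time a solution of g' = [kin] g takes from height [x] to infinity, equal to [F (expR x)]. *)
Definition tail_time (x : R) : R := fine (\int[leb]_(u in `[x, +oo[) (slow u)%:E)%E.

Lemma slow_ge0 u : 0 < u -> (0 <= (slow u)%:E)%E.
Proof. by move=> u0; rewrite lee_fin ltW// slow_gt0. Qed.

Lemma tail_integral_le x : 0 < x ->
  (\int[leb]_(u in `[x, +oo[) (slow u)%:E <= (4 * x^-1)%:E)%E.
Proof.
move=> x0; rewrite -integral_invsqr//; apply: ge0_le_integral => //.
- by move=> u /(itv_gt0 x0) /=; rewrite in_itv/= andbT; exact: slow_ge0.
- by apply/measurable_EFinP; apply: measurable_slow => //; exact: itv_gt0.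
- apply/measurable_EFinP; apply: measurable_funS (itv_gt0 x0) _ => //.
  apply: open_continuous_measurable_fun => // u.
  by rewrite inE/= in_itv/= andbT; exact: continuous_invsqr.
- move=> u /(itv_gt0 x0) /=; rewrite in_itv/= andbT lee_fin; exact: slow_le_sqr.
Qed.

Lemma tail_timeE x : 0 < x ->
  (\int[leb]_(u in `[x, +oo[) (slow u)%:E = (tail_time x)%:E)%E.
Proof.
move=> x0; rewrite fineK// ge0_fin_numE.
  by rewrite (le_lt_trans (tail_integral_le x0)) ?ltry.
apply: integral_ge0 => u /(itv_gt0 x0) /=; rewrite in_itv/= andbT; exact: slow_ge0.
Qed.

Lemma tail_time_le x : 0 < x -> tail_time x <= 4 * x^-1.
Proof. by move=> x0; rewrite -lee_fin -tail_timeE// tail_integral_le. Qed.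

Lemma tail_time_ge0 x : 0 < x -> 0 <= tail_time x.
Proof.
move=> x0; rewrite fine_ge0//; apply: integral_ge0 => u /(itv_gt0 x0) /=.
by rewrite in_itv/= andbT; exact: slow_ge0.
Qed.

Lemma integrable_slow x y : 0 < x -> leb.-integrable `[x, y] (EFin \o (@slow R)).
Proof.
move=> x0; have sub : `[x, y]%classic `<=` `[x, +oo[%classic.
  by move=> u /=; rewrite !in_itv/= andbT => /andP[].
have iI : leb.-integrable `[x, +oo[ (EFin \o (@slow R)).
  apply/integrableP; split.
    by apply/measurable_EFinP; apply: measurable_slow => //; exact: itv_gt0.
  apply: (le_lt_trans _ (ltry (tail_time x))); rewrite -tail_timeE//.
  rewrite le_eqVlt; apply/orP; left; apply/eqP/eq_integral => u.
  rewrite inE => /(itv_gt0 x0) /=; rewrite in_itv/= andbT => u0.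
  by rewrite /= ger0_norm// ltW// slow_gt0.
by apply: (@integrableS _ _ _ leb `[x, +oo[%classic `[x, y]%classic (EFin \o @slow R)).
Qed.

Lemma tail_time_split x y : 0 < x -> x <= y ->
  tail_time x = (\int[leb]_(u in `[x, y]) slow u)%R + tail_time y.
Proof.
move=> x0 xy; apply: EFin_inj.
rewrite EFinD -(tail_timeE x0) -(tail_timeE (lt_le_trans x0 xy)).
have mS : measurable_fun `[x, +oo[ (EFin \o (@slow R)).
  by apply/measurable_EFinP; apply: measurable_slow => //; exact: itv_gt0.
have sU : `[x, +oo[%classic = `[x, y] `|` `]y, +oo[%classic :> set R.
  by rewrite -itv_bndbnd_setU// bnd_simp.
rewrite /Rintegral fineK; last exact: integrable_fin_num (integrable_slow y x0).
rewrite -(@integral_itv_obnd_cbnd _ y); last first.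
  apply: measurable_funS mS => //; first by rewrite sU; exact: subsetUr.
rewrite sU ge0_integral_setU//.
- by rewrite -sU.
- move=> u; rewrite -sU => /(itv_gt0 x0) /=; rewrite in_itv/= andbT; exact: slow_ge0.
- apply/disj_setPS => u [] /=; rewrite !in_itv/= andbT => /andP[_ uy] yu.
  by have := lt_le_trans yu uy; rewrite ltxx.
Qed.

Lemma is_derive_tail_time x : 0 < x -> is_derive x 1 tail_time (- slow x).
Proof.
(* Near [x] the tail is a constant minus the integral from the fixed base point [a], to which the
   fundamental theorem of calculus applies. *)
move=> x0; pose a := x / 2; have a0 : 0 < a by rewrite divr_gt0.
have ax : a < x by rewrite /a ltr_pdivrMr// ltr_pMr// ltr1n.
pose I (t : R) : R := (\int[leb]_(u in `[a, t]) slow u)%R.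
have x1 : x < x + 1 by rewrite ltrDl.
have [dI I'] := @continuous_FTC1_closed R (@slow R) a x (x + 1)
  x1 (integrable_slow _ a0) ax (continuous_slow x0).
have isI : is_derive x 1 I (slow x) 
  by apply: DeriveDef; [exact: dI|rewrite -derive1E; exact: I'].
apply: (@near_eq_is_derive _ _ _ (cst (tail_time a) - I)); last first.
  by apply: is_derive_eq; rewrite sub0r.
near=> t; rewrite /= (tail_time_split a0 (y := t)).
  by rewrite fctE /= /I addrC addKr.
by apply: ltW; near: t; exact: lt_nbhsr.
Unshelve. all: by end_near. Qed.

End explosion_time.

(** * The regularised integral defining [rstar] *)

Section explosion_constant.
Context (R : realType).
Implicit Types x y u v : R.
Local Notation leb := (@lebesgue_measure R).

Definition defect (u : R) : R := u^-1 - slow u.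

Lemma defect_ge0 u : 0 < u -> 0 <= defect u.
Proof. by move=> u0; rewrite subr_ge0 slow_le. Qed.

Lemma defect_le u : 0 < u -> defect u <= 2^-1.
Proof. by move=> u0; have := slow_ge u0; rewrite /defect; lra. Qed.

Lemma continuous_defect u : 0 < u -> {for u, continuous defect}.
Proof.
move=> u0; apply: cvgB; last exact: continuous_slow.
by apply: inv_continuous; rewrite gt_eqF.
Qed.

Lemma measurable_of_continuous_gt0 (f : R -> R) (D : set R) :
  (forall u, 0 < u -> {for u, continuous f}) -> D `<=` `]0, +oo[ -> measurable D ->
  measurable_fun D (EFin \o f).
Proof.
move=> cf D0 mD; apply/measurable_EFinP; apply: (measurable_funS _ D0) => //.
apply: open_continuous_measurable_fun => // x.
by rewrite inE/= in_itv/= andbT; exact: cf.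
Qed.

(** The positive part of the integrand lives on [[1, +oo[] and, because [slow u <= u^-1], the
    negative part on []0, 1[]. *)
Lemma rstar_integralE :
  (\int[leb]_(u in `]0%R, +oo[) (rstar_integrand u)%:E =
   (tail_time 1)%:E - \int[leb]_(u in `]0%R, 1%R[) (defect u)%:E)%E.
Proof.
have sU : `]0, +oo[%classic = `]0, 1[ `|` `[1, +oo[ :> set R.
  by rewrite -itv_bndbnd_setU// bnd_simp.
have s1 : `]0, 1[%classic `<=` (`]0, +oo[%classic : set R).
  by rewrite sU; exact: subsetUl.
have s2 : `[1, +oo[%classic `<=` (`]0, +oo[%classic : set R).
  by rewrite sU; exact: subsetUr.
have dis : [disjoint (`]0, 1[%classic : set R) & `[1, +oo[%classic].
  apply/disj_setPS => u [] /=; rewrite !in_itv/= andbT => /andP[_ u1] u1'.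
  by have := lt_le_trans u1 u1'; rewrite ltxx.
have mf : measurable_fun (`]0, +oo[%classic : set R) (fun u : R => (rstar_integrand u)%:E).
  rewrite sU; apply/measurable_funU => //; split.
    apply: (@eq_measurable_fun _ _ _ _ _ (EFin \o (fun u => - defect u))) => [u|].
      rewrite inE /rstar_integrand/= in_itv/= => /andP[_ ->].
      by rewrite /defect /slow /kin /kin2 opprB.
    apply: measurable_of_continuous_gt0 s1 _ => // u u0.
    by apply: cvgN; exact: continuous_defect.
  apply: (@eq_measurable_fun _ _ _ _ _ (EFin \o @slow R)) => [u|].
    rewrite inE /rstar_integrand/= in_itv/= andbT leNgt => /negbTE ->.
    by rewrite subr0.
  by apply: measurable_of_continuous_gt0 s2 _ => // u u0; exact: continuous_slow.
rewrite integralE; congr (_ - _)%E.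
- rewrite sU ge0_integral_setU//; last first.
    by rewrite -sU; exact: measurable_funepos.
  rewrite integral0_eq ?add0e; last first.
    move=> u /=; rewrite in_itv/= => /andP[u0 u1].
    rewrite funeposE /rstar_integrand u1; apply/max_idPr.
    by rewrite lee_fin subr_le0; exact: slow_le.
  rewrite -tail_timeE//; apply: eq_integral => u; rewrite inE/= in_itv/= andbT => u1.
  rewrite funeposE /rstar_integrand ltNge u1/= subr0; apply/max_idPl.
  by rewrite lee_fin; apply/ltW/slow_gt0/(lt_le_trans ltr01).
- rewrite sU ge0_integral_setU//; last first.
    by rewrite -sU; exact: measurable_funeneg.
  rewrite [X in (_ + X)%E]integral0_eq ?adde0; last first.
    move=> u /=; rewrite in_itv/= andbT => u1.
    rewrite funenegE /rstar_integrand ltNge u1/= subr0; apply/max_idPr.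
    by rewrite lee_fin oppr_le0; apply/ltW/slow_gt0/(lt_le_trans ltr01).
  apply: eq_integral => u; rewrite inE/= in_itv/= => /andP[u0 u1].
  rewrite funenegE /rstar_integrand u1 -EFinN opprB; apply/max_idPl.
  by rewrite lee_fin; exact: defect_ge0.
Qed.

Lemma integral_inv x : 0 < x -> x < 1 ->
  (\int[leb]_(u in `[x, 1%R]) (u^-1)%:E = (- ln x)%:E)%E.
Proof.
move=> x0 x1.
rewrite (@continuous_FTC2 R (fun u => u^-1) (@ln R))//.
- by rewrite ln1 sub0e.
- apply: continuous_in_subspaceT => u; rewrite inE/= in_itv/= => /andP[xu _].
  by apply: inv_continuous; rewrite gt_eqF// (lt_le_trans x0).
- split.
  + move=> u; rewrite in_itv/= => /andP[xu _].
    by have [] := is_derive1_ln (lt_trans x0 xu).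
  + by apply: cvg_at_right_filter; exact: continuous_ln.
  + by apply: cvg_at_left_filter; exact: continuous_ln.
- move=> u; rewrite in_itv/= => /andP[xu _].
  by rewrite derive1E; have [_ ->] := is_derive1_ln (lt_trans x0 xu).
Qed.

(** The middle term is [ln x] minus the integral of [defect] over []0, x[], and [defect] lies
    between 0 and 1/2. The cut-off at 1 cancels because [- ln x] is the integral of [u^-1] from [x]
    to 1. *)
Lemma rstar_bounds x : 0 < x -> x < 1 ->
  ln x - x / 2 <= ln (rstar R) - tail_time x <= ln x.
Proof.
(* Here [a] and [b] are the integrals of [defect] over []0, x[] and [[x, 1]], [k] is that of [slow]
   over [[x, 1]], [t] is [tail_time 1], [l] is [ln x] and [h] is [x / 2]. *)
have aux (a b k l t h : R) : 0 <= a -> a <= h -> b + k = - l ->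
    l - h <= t - (a + b) - (k + t) <= l by move=> *; lra.
move=> x0 x1.
have sxo : `[x, 1]%classic `<=` (`]0, +oo[%classic : set R).
  by move=> u /=; rewrite !in_itv/= andbT => /andP[xu _]; exact: lt_le_trans xu.
have s0x : `]0, x[%classic `<=` (`]0, +oo[%classic : set R).
  by move=> u /=; rewrite !in_itv/= andbT => /andP[].
have s01 : `]0, 1[%classic `<=` (`]0, +oo[%classic : set R).
  by move=> u /=; rewrite !in_itv/= andbT => /andP[].
have sx1 : `[x, 1[%classic `<=` (`]0, +oo[%classic : set R).
  by move=> u /=; rewrite !in_itv/= andbT => /andP[xu _]; exact: lt_le_trans xu.
have md (D : set R) : D `<=` `]0, +oo[ -> measurable D -> measurable_fun D (EFin \o defect).
  exact: measurable_of_continuous_gt0 continuous_defect.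
have ms (D : set R) : D `<=` `]0, +oo[ -> measurable D -> measurable_fun D (EFin \o @slow R).
  exact: measurable_of_continuous_gt0 (@continuous_slow R).
have d0 (D : set R) : D `<=` `]0, +oo[ -> forall u, D u -> (0 <= (defect u)%:E)%E.
  by move=> D0 u /D0 /=; rewrite in_itv/= andbT lee_fin; exact: defect_ge0.
have k0 (D : set R) : D `<=` `]0, +oo[ -> forall u, D u -> (0 <= (slow u)%:E)%E.
  by move=> D0 u /D0 /=; rewrite in_itv/= andbT; exact: slow_ge0.
pose a := (\int[leb]_(u in `]0%R, x[) (defect u)%:E)%E.
pose b := (\int[leb]_(u in `[x, 1%R]) (defect u)%:E)%E.
have a0 : (0 <= a)%E by apply: integral_ge0; exact: d0.
have b0 : (0 <= b)%E by apply: integral_ge0; exact: d0.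
have ax : (a <= (x / 2)%:E)%E.
  apply: (@le_trans _ _ (\int[leb]_(u in `]0%R, x[) (2^-1)%:E)%E).
    apply: ge0_le_integral => //; [exact: d0|exact: md|].
    by move=> u /s0x /=; rewrite in_itv/= andbT lee_fin; exact: defect_le.
  have lx : leb `]0, x[%classic = x%:E.
    by rewrite lebesgue_measure_itv/= lte_fin x0 oppr0 adde0.
  by rewrite integral_cst// [X in (_ * X)%E]lx -EFinM lee_fin mulrC.
have abE : (\int[leb]_(u in `]0%R, 1%R[) (defect u)%:E = a + b)%E.
  have sU : `]0, 1[%classic = `]0, x[ `|` `[x, 1[ :> set R.
    by rewrite -itv_bndbnd_setU// bnd_simp// ltW.
  rewrite sU ge0_integral_setU//.
  - congr (_ + _)%E; rewrite integral_itv_bndo_bndc//; exact: md.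
  - by rewrite -sU; exact: md.
  - by move=> u; rewrite -sU; exact: d0.
  - apply/disj_setPS => u [] /=; rewrite !in_itv/= => /andP[_ ux] /andP[xu _].
    by have := lt_le_trans ux xu; rewrite ltxx.
have bk : (b + (\int[leb]_(u in `[x, 1%R]) slow u)%R%:E = (- ln x)%:E)%E.
  rewrite -integral_inv// /Rintegral fineK; last first.
    exact: integrable_fin_num (integrable_slow 1 x0).
  rewrite /b -ge0_integralD//; [|exact: d0|exact: md|exact: k0|exact: ms].
  by apply: eq_integral => u _; rewrite -EFinD /defect subrK.
rewrite /rstar expRK rstar_integralE abE (tail_time_split x0 (ltW x1)).
move: a b a0 b0 ax bk {abE} => [a| |] [b| |] //=; rewrite !lee_fin => a0 b0 ax.
by rewrite -EFinD => -[]; exact: aux.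
Qed.

End explosion_constant.

(** * The solution as the inverse of its clock *)

Section explosion_profile.
Context (R : realType).
Implicit Types x y u v t : R.
Local Notation leb := (@lebesgue_measure R).
Local Notation L := (ln (rstar R)).

(* [profile v], the inverse of [clock], is the logarithm of the moment
   generating function of the limit at [expR v]. *)
Definition clock x := L - tail_time x.

Lemma is_derive_clock x : 0 < x -> is_derive x 1 clock (slow x).
Proof.
move=> x0; have h := is_derive_tail_time x0.
by apply: (is_derive_eq (is_deriveB (is_derive_cst L x 1) h)); rewrite sub0r opprK.
Qed.

Lemma monotone_gt0 (f df : R -> R) a b : 0 < a -> a <= b ->
  (forall x, 0 < x -> is_derive x 1 f (df x)) ->
  (forall x, 0 < x -> 0 <= df x) -> f a <= f b.
Proof.
move=> a0 ab fdf df0; apply: (@monotone_of_derive R f df) => // x ax.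
  exact/fdf/(lt_le_trans a0).
exact/df0/(lt_le_trans a0).
Qed.

(** Below 1 this is [rstar_bounds]. It extends from the point 1/2 to the right because
    [ln x - clock x] has derivative [x^-1 - slow x], which is nonnegative. *)
Lemma clock_le_ln x : 0 < x -> clock x <= ln x.
Proof.
move=> x0; have [x1|x1] := ltP x 1; first by have /andP[] := rstar_bounds x0 x1.
have h0 : (0 : R) < 2^-1 by rewrite invr_gt0.
have h1 : (2^-1 : R) < 1 by rewrite invf_lt1// ltr1n.
have /andP[_] := rstar_bounds h0 h1; rewrite -/(clock _) -subr_ge0 => h.
rewrite -subr_ge0 (le_trans h)//.
apply: (@monotone_gt0 (fun x => ln x - clock x) (fun x => x^-1 - slow x)) => //.
- exact: le_trans (ltW h1) x1.
- move=> y y0; have ? := is_derive1_ln y0; have ? := is_derive_clock y0.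
  exact: is_deriveB.
- by move=> y y0; rewrite subr_ge0 slow_le.
Qed.

Lemma clock_ge_ln x : 0 < x -> ln x - x / 2 <= clock x.
Proof.
move=> x0; have [x1|x1] := ltP x 1; first by have /andP[] := rstar_bounds x0 x1.
have h0 : (0 : R) < 2^-1 by rewrite invr_gt0.
have h1 : (2^-1 : R) < 1 by rewrite invf_lt1// ltr1n.
have /andP[+ _] := rstar_bounds h0 h1; rewrite -/(clock _) -subr_ge0 => h.
rewrite -subr_ge0 (le_trans h)//.
apply: (@monotone_gt0 (fun x => clock x - (ln x - x / 2))
   (fun x => slow x - (x^-1 - 2^-1))) => //.
- exact: le_trans (ltW h1) x1.
- move=> y y0; have h2 := is_derive1_ln y0; have h3 := is_derive_clock y0.
  have h4 : is_derive y 1 (fun x => x / 2) (2^-1 : R).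
    have h5 := @is_deriveZ R R R id (2^-1) y 1 1 (is_derive_id y 1).
    rewrite (_ : (fun x => x / 2) = 2^-1 *: id); last first.
      by apply/funext => z; rewrite mulrC.
    by apply: (is_derive_eq h5); rewrite /GRing.scale/= mulr1.
  by apply: is_deriveB; apply: is_deriveB.
- by move=> y y0; rewrite subr_ge0 slow_ge.
Qed.

Lemma derivable_clock x : 0 < x -> derivable clock x 1.
Proof. by move=> x0; have [] := is_derive_clock x0. Qed.

Lemma continuous_clock x : 0 < x -> {for x, continuous clock}.
Proof.
by move=> x0; apply/differentiable_continuous/derivable1_diffP/derivable_clock.
Qed.

Lemma clock_lt x y : 0 < x -> x < y -> clock x < clock y.
Proof.
move=> x0 xy.
have [z|c cxy|c /itvP cxy fE] := @MVT_segment R clock (@slow R) x y (ltW xy).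
- by rewrite in_itv/= => /andP[xz _]; exact/is_derive_clock/(lt_trans x0).
- apply: derivable_within_continuous => z; rewrite in_itv/= => /andP[xz _].
  exact/derivable_clock/(lt_le_trans x0).
rewrite -subr_gt0 fE mulr_gt0 ?subr_gt0// slow_gt0//.
by rewrite (lt_le_trans x0)// cxy.
Qed.

Lemma clock_inj x y : 0 < x -> 0 < y -> clock x = clock y -> x = y.
Proof.
move=> x0 y0 e; have [xy|yx|//] := ltgtP x y.
  by have := clock_lt x0 xy; rewrite e ltxx.
by have := clock_lt y0 yx; rewrite e ltxx.
Qed.

Lemma clock_ltL x : 0 < x -> clock x < L.
Proof.
move=> x0; have x1 : x < x + 1 by rewrite ltrDl.
rewrite (lt_le_trans (clock_lt x0 x1))// /clock gerBl tail_time_ge0//.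
by rewrite addr_gt0.
Qed.

Lemma clock_surj v : v < L -> exists2 x, 0 < x & clock x = v.
Proof.
(* The root is bracketed by [clock_le_ln] at [expR v] and by [tail_time_le] at [b]. *)
move=> vL; pose a := expR v.
pose b := Num.max (expR v) (4 / (L - v)).
have a0 : 0 < a := expR_gt0 v.
have Lv : 0 < L - v by rewrite subr_gt0.
have ab : a <= b by rewrite le_max lexx.
have b0 : 0 < b := lt_le_trans a0 ab.
have va : clock a <= v by rewrite (le_trans (clock_le_ln a0))// expRK.
have vb : v <= clock b.
  rewrite /clock lerBrDr addrC -lerBrDr (le_trans (tail_time_le b0))//.
  rewrite ler_pdivrMr// mulrC -ler_pdivrMr//.
  by rewrite le_max lexx orbT.
have [||c cab cE] := @IVT R clock a b v ab.
  apply: derivable_within_continuous => z; rewrite in_itv/= => /andP[az _].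
  exact/derivable_clock/(lt_le_trans a0).
  by rewrite ge_min va le_max vb orbT.
exists c => //; move: cab; rewrite in_itv/= => /andP[ac _].
exact: lt_le_trans ac.
Qed.

Definition profile v : R := xget 0 [set x | 0 < x /\ clock x = v].

Lemma profileP v : v < L -> 0 < profile v /\ clock (profile v) = v.
Proof.
move=> /clock_surj[x x0 xv]; rewrite /profile.
by case: xgetP => [y _ []//|/(_ x) h]; exfalso; apply: h.
Qed.

Lemma profile_gt0 v : v < L -> 0 < profile v.
Proof. by move=> /profileP[]. Qed.

Lemma clockK x : 0 < x -> profile (clock x) = x.
Proof.
move=> x0; have [p0 pE] := profileP (clock_ltL x0).
exact: clock_inj.
Qed.

Lemma is_derive_profile v : v < L -> is_derive v 1 profile (kin (profile v)).
Proof.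
move=> vL; have [p0 pE] := profileP vL.
rewrite -[X in is_derive X]pE -[kin _]invrK; apply: is_derive_inverse.
- near=> y; apply: clockK; near: y; exact: lt_nbhsr.
- near=> y; apply: continuous_clock; near: y; exact: lt_nbhsr.
- exact: is_derive_clock.
- by rewrite gt_eqF// slow_gt0.
Unshelve. all: by end_near. Qed.

Lemma continuous_profile v : v < L -> {for v, continuous profile}.
Proof.
move=> vL; apply/differentiable_continuous/derivable1_diffP.
by have [] := is_derive_profile vL.
Qed.

Lemma profile_lt v x : 0 < x -> v < clock x -> profile v < x.
Proof.
move=> x0 vx; have [p0 pE] := profileP (lt_trans vx (clock_ltL x0)).
rewrite ltNge; apply/negP; rewrite le_eqVlt => /predU1P[e|xp].
  by move: vx; rewrite -pE -e ltxx.
by have := lt_trans vx (clock_lt x0 xp); rewrite pE ltxx.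
Qed.

Lemma expR_le_profile v : v < L -> expR v <= profile v.
Proof.
move=> vL; have [p0 pE] := profileP vL.
by rewrite -[leRHS]lnK ?posrE// ler_expR -[leLHS]pE clock_le_ln.
Qed.

Lemma profile_le v : v < L -> profile v * expR (- (profile v / 2)) <= expR v.
Proof.
move=> vL; have [p0 pE] := profileP vL.
rewrite -[X in X * _]lnK ?posrE// -expRD ler_expR -[leRHS]pE.
exact: clock_ge_ln.
Qed.

Lemma profile_nd u v : v < L -> u <= v -> profile u <= profile v.
Proof.
move=> vL; rewrite le_eqVlt => /predU1P[-> //|uv].
have [p0 pE] := profileP vL.
by apply/ltW/profile_lt => //; rewrite pE.
Qed.

Lemma profile_cvg0 v : profile (v - t) @[t --> +oo] --> 0.
Proof.
apply/cvgrPdist_lt => e e0; near=> t.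
have vt : v - t < clock e.
  by rewrite ltrBlDl -ltrBlDr; near: t;
  apply: nbhs_pinfty_gt; exact: num_real.
have vtL : v - t < L := lt_trans vt (clock_ltL e0).
by rewrite sub0r normrN gtr0_norm ?profile_gt0// profile_lt.
Unshelve. all: by end_near. Qed.

Lemma kin_profile_cvg0 v : kin (profile (v - t)) @[t --> +oo] --> 0.
Proof.
apply: (@squeeze_cvgr _ _ _ _ (cst 0)
  (fun t => profile (v - t) * expR (profile (v - t) / 2))).
- near=> t; have vtL : v - t < L.
    by rewrite ltrBlDl -ltrBlDr; near: t;
  apply: nbhs_pinfty_gt; exact: num_real.
  by rewrite /= sqrtr_ge0 kin_le// ltW// profile_gt0.
- exact: cvg_cst.
- rewrite -[X in _ --> X](mul0r (expR (0 / 2))); apply: cvgM.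
    exact: profile_cvg0.
  have h : (profile (v - t) / 2) @[t --> +oo] --> (0 / 2 : R).
    by apply: cvgM; [exact: profile_cvg0|exact: cvg_cst].
  exact: (cvg_comp _ _ h (@continuous_expR R (0 / 2))).
Unshelve. all: by end_near. Qed.

Lemma is_derive_shift (f : R -> R) (df : R) v t :
  is_derive (v - t) 1 f df -> is_derive t 1 (fun t => - f (v - t)) df.
Proof.
move=> fdf.
have h : is_derive t 1 (fun t => v - t) (-1).
  have h1 := is_derive_id t (1 : R); have h2 := is_derive_cst v t (1 : R).
  by apply: (is_derive_eq (is_deriveB h2 h1)); rewrite sub0r.
have h3 := @is_deriveN _ _ _ _ _ _ _ (@is_derive1_comp R f (fun t => v - t) t _ _ fdf h).
by apply: (is_derive_eq h3); rewrite mulrN1 opprK.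
Qed.

(** A primitive in [t] is [- f (v - t)], which vanishes at [+oo]. Used for [profile] and for
    [kin (profile _)], this integrates the second-order equation in two steps that match the two
    integrals of the recursion. *)
Lemma integral_shift (f df : R -> R) v : v < L ->
  (forall u, u < L -> is_derive u 1 f (df u)) ->
  (forall u, u < L -> 0 <= df u) ->
  (forall u, u < L -> {for u, continuous df}) ->
  f (v - t) @[t --> +oo] --> 0 ->
  (\int[leb]_(t in `[0%R, +oo[) (df (v - t)%R)%:E = (f v)%:E)%E.
Proof.
move=> vL fdf df0 cdf f0.
have vtL t : 0 <= t -> v - t < L by move=> t0; rewrite (le_lt_trans _ vL)// gerBl.
have der t : 0 <= t -> is_derive t 1 (fun t => - f (v - t)) (df (v - t)).
  by move=> t0; apply/is_derive_shift/fdf/vtL.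
rewrite (@ge0_continuous_FTC2y _ (fun t => df (v - t)) (fun t => - f (v - t)) 0 0).
- by rewrite sub0e subr0 -EFinN opprK.
- by move=> t t0; exact/df0/vtL.
- apply: continuous_in_subspaceT => t; rewrite inE/= in_itv/= andbT => t0.
  apply: (@continuous_comp _ _ _ (fun t => v - t) df); last exact/cdf/vtL.
  by apply: cvgB; [exact: cvg_cst|exact: cvg_id].
- by rewrite -oppr0; apply: cvgN.
- by move=> t /ltW t0; have [] := der t t0.
- apply: cvg_at_right_filter.
  by have [/derivable1_diffP/differentiable_continuous] := der 0 (lexx 0).
- move=> t; rewrite in_itv/= andbT => /ltW t0.
  by rewrite derive1E; have [_ ->] := der t t0.
Qed.

Lemma integral_kin_profile v : v < L ->
  (\int[leb]_(t in `[0%R, +oo[) (kin (profile (v - t)%R))%:E = (profile v)%:E)%E.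
Proof.
move=> vL; have h := @integral_shift profile (fun u => kin (profile u)) v vL.
apply: h => //.
- by move=> u; exact: is_derive_profile.
- by move=> u _; exact: sqrtr_ge0.
- move=> u uL; have h1 := continuous_kin (profile_gt0 uL).
  exact: (@continuous_comp _ _ _ profile (@kin R) u (continuous_profile uL) h1).
- exact: profile_cvg0.
Qed.

Lemma integral_expR_profile v : v < L ->
  (\int[leb]_(t in `[0%R, +oo[) (expR (profile (v - t)%R) - 1)%:E =
   (kin (profile v))%:E)%E.
Proof.
move=> vL.
have h := @integral_shift (fun u => kin (profile u))
  (fun u => expR (profile u) - 1) v vL.
apply: h => //.
- move=> u uL; have p0 := profile_gt0 uL.
  apply: (is_derive_eq (is_derive1_comp (is_derive_kin p0) (is_derive_profile uL))).
  by rewrite divfK// gt_eqF// kin_gt0.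
- by move=> u uL; rewrite subr_ge0 -expR0 ler_expR ltW// profile_gt0.
- move=> u uL; apply: cvgB; last exact: cvg_cst.
  apply: (@continuous_comp _ _ _ profile expR); first exact: continuous_profile.
  exact: continuous_expR.
- exact: kin_profile_cvg0.
Qed.

Lemma FE y : F y = tail_time (ln y).
Proof. by []. Qed.

(** Since [F y] is [tail_time (ln y)], the equation [F y = L - ln r] says that
    [clock (ln y) = ln r]. *)
Lemma FinvE r : 0 < r -> r < rstar R -> Finv (L - ln r) = expR (profile (ln r)).
Proof.
move=> r0 rr; have vL : ln r < L by rewrite ltr_ln// posrE// expR_gt0.
have [p0 pE] := profileP vL.
have aux y : 1 < y -> F y = L - ln r -> y = expR (profile (ln r)).
  move=> y1 Fy; have y0 : 0 < y := lt_trans ltr01 y1.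
  rewrite -[y in LHS]lnK ?posrE//; congr expR.
  apply: clock_inj => //; first exact: ln_gt0.
  by rewrite pE /clock -FE Fy opprB addrCA subrr addr0.
rewrite /Finv; case: xgetP => [y _ [y1 Fy]|/(_ (expR (profile (ln r))))]; first exact: aux.
case; split; first by rewrite -expR0 ltr_expR.
by rewrite FE expRK -[in RHS]pE /clock opprB addrCA subrr addr0.
Qed.

End explosion_profile.

(** * Convergence of the recursion *)

Section comparison.
Context (R : realType).
Implicit Types (u v t : R) (n : nat).
Local Notation leb := (@lebesgue_measure R).
Local Notation mu2 := (@lebesgue_measure R \x @lebesgue_measure R)%E.
Local Notation L := (ln (rstar R)).
Local Open Scope ereal_scope.

Lemma integral_quadrant (g : R -> \bar R) (s : R) : measurable_fun setT g ->
  (forall r, 0 <= g r) ->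
  \int[mu2]_(z in quadrant) g (s * wt z)%R =
  \int[leb]_(t in `]0%R, +oo[) \int[leb]_(x in `]0%R, +oo[) g (s * expR (- t - x))%R.
Proof.
move=> mg g0.
have mgw : measurable_fun setT (fun z : R * R => g (s * wt z)%R).
  by apply: measurableT_comp => //; apply: measurable_funM => //; exact: measurable_wt.
rewrite integral_mkcond fubini_tonelli1.
- rewrite [RHS]integral_mkcond; apply: eq_integral => t _.
  rewrite /fubini_F /= [RHS]patchE; case: ifPn => [t0|t0].
    rewrite [RHS]integral_mkcond; apply: eq_integral => x _.
    rewrite !patchE; move: t0; rewrite inE/= in_itv/= andbT => t0.
    have [x0|x0] := ltP 0%R x.
      by rewrite mem_set//= mem_set//= in_itv/= andbT.
    rewrite memNset => [|[_ /=]]; last by rewrite ltNge x0.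
    by rewrite memNset//= in_itv/= andbT ltNge x0.
  rewrite integral0_eq// => x _; rewrite patchE memNset// => -[/= t0'] _.
  by move/negP: t0; apply; rewrite inE/= in_itv/= andbT.
- apply/(measurable_restrictT _ (@measurable_quadrant R)).
  exact: measurable_funTS.
- by move=> z; rewrite erestrict_ge0.
Qed.

(** The inner integral of the recursion. Its counterpart for the fixed point is [kin (profile v)],
    by [integral_expR_profile]. *)
Definition excess n v := \int[leb]_(x in `[0%R, +oo[) (phi n (expR (v - x)) - 1).

Let measurable_phi_expR n v : measurable_fun setT (fun x : R => phi n (expR (v - x)) - 1).
Proof.
apply: emeasurable_funB; last exact: measurable_cst.
apply: measurableT_comp; first exact: measurable_phi.
apply: measurableT_comp; first exact: measurable_expR.
exact: measurable_funB.
Qed.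

Lemma phi_sub_ge0 n (s : R) : 0 <= phi n s - 1.
Proof. by rewrite sube_ge0// phi_ge1. Qed.

Lemma measurable_excess n : measurable_fun setT (excess n).
Proof.
pose f (y : R * R) := (phi n (expR (y.1 - y.2)) - 1) * (\1_(`[0%R, +oo[%classic : set R) y.2)%:E.
have f0 y : 0 <= f y by rewrite mule_ge0 ?lee_fin// phi_sub_ge0.
have mi : measurable_fun setT (\1_(`[0%R, +oo[%classic : set R) : R -> R).
  by apply: measurable_indic; exact: measurable_itv.
have mf : measurable_fun setT f.
  apply: emeasurable_funM; last first.
    apply/measurable_EFinP; apply: (measurableT_comp mi); exact: measurable_snd.
  apply: emeasurable_funB; last exact: measurable_cst.
  apply: measurableT_comp; first exact: measurable_phi.
  apply: measurableT_comp; first exact: measurable_expR.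
  exact: measurable_funB.
pose l : {sigma_finite_measure set (measurableTypeR R) -> \bar R} := leb.
have -> : excess n = fubini_F l f.
  by apply/funext => v; rewrite /excess integral_mkcond epatch_indic.
exact: (@measurable_fun_fubini_tonelli_F _ _ _ _ R l f mf f0).
Qed.

Lemma phiS_excess n v :
  phi n.+1 (expR v) = expeR (\int[leb]_(t in `[0%R, +oo[) excess n (v - t)%R).
Proof.
rewrite phiS (@integral_quadrant (fun r => phi n r - 1)); last 2 first.
- by apply: emeasurable_funB; [exact: measurable_phi|exact: measurable_cst].
- by move=> r; exact: phi_sub_ge0.
have E t : \int[leb]_(x in `]0%R, +oo[) (phi n (expR v * expR (- t - x))%R - 1) =
    excess n (v - t)%R.
  rewrite /excess -integral_itv_obnd_cbnd; last exact: measurable_funTS.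
  by apply: eq_integral => x _; rewrite -expRD addrA.
congr expeR; under eq_integral do rewrite E.
rewrite integral_itv_obnd_cbnd//; apply: measurable_funTS.
apply: measurableT_comp; [exact: measurable_excess|exact: measurable_funB].
Qed.

Lemma excess_ge0 n v : 0 <= excess n v.
Proof. by apply: integral_ge0 => x _; exact: phi_sub_ge0. Qed.

Lemma measurable_shift (f : R -> R) v : (v < L)%R ->
  (forall u, (u < L)%R -> {for u, continuous f}) ->
  measurable_fun (`[0%R, +oo[%classic : set R) (fun t => (f (v - t)%R)%:E).
Proof.
move=> vL cf; apply/measurable_EFinP.
have sub : `[0%R, +oo[%classic `<=` (`](v - L)%R, +oo[%classic : set R).
  move=> t /=; rewrite !in_itv/= !andbT; apply: lt_le_trans.
  by rewrite subr_lt0.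
apply: (measurable_funS _ sub) => //.
apply: open_continuous_measurable_fun => // t.
rewrite inE/= in_itv/= andbT => vt.
apply: (@continuous_comp _ _ _ (fun t => v - t)%R f).
  by apply: cvgB; [exact: cvg_cst|exact: cvg_id].
by apply: cf; rewrite ltrBlDl -ltrBlDr.
Qed.

Let continuous_expR_profile u : (u < L)%R ->
  {for u, continuous (fun u => expR (profile u) - 1)%R}.
Proof.
move=> uL; apply: cvgB; last exact: cvg_cst.
apply: (@continuous_comp _ _ _ (@profile R) expR); first exact: continuous_profile.
exact: continuous_expR.
Qed.

Let continuous_kin_profile u : (u < L)%R ->
  {for u, continuous (fun u => kin (profile u))}.
Proof.
move=> uL; have h1 := continuous_kin (profile_gt0 uL).
exact: (@continuous_comp _ _ _ (@profile R) (@kin R) u (continuous_profile uL) h1).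
Qed.

Let sub_ltL v t : (v < L)%R -> (`[0%R, +oo[%classic : set R) t -> (v - t < L)%R.
Proof.
by move=> vL /=; rewrite in_itv/= andbT => t0; rewrite (le_lt_trans _ vL)// gerBl.
Qed.

(** The recursion is monotone and the right-hand side is a fixed point of it that starts above
    [phi 0], by [expR_le_profile]; the two integrations are compared one at a time. *)
Lemma phi_le_profile n v : (v < L)%R -> phi n (expR v) <= (expR (profile v))%:E.
Proof.
elim: n v => [|n IH] v vL.
  by rewrite /= lee_fin ler_expR ger0_norm ?expR_ge0// expR_le_profile.
have Jn u : (u < L)%R -> excess n u <= (kin (profile u))%:E.
  move=> uL; rewrite -integral_expR_profile//; apply: ge0_le_integral => //.
  - by move=> x _; exact: phi_sub_ge0.
  - exact: measurable_funTS (measurable_phi_expR n u).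
  - exact: (measurable_shift uL continuous_expR_profile).
  - by move=> x /(sub_ltL uL) uxL; rewrite EFinB leeB// IH.
rewrite phiS_excess -[leRHS]/(expeR (profile v)%:E) lee_expeR.
rewrite -integral_kin_profile//; apply: ge0_le_integral => //.
- by move=> x _; exact: excess_ge0.
- apply: measurable_funTS; apply: measurableT_comp; first exact: measurable_excess.
  exact: measurable_funB.
- exact: (measurable_shift vL continuous_kin_profile).
- by move=> x /(sub_ltL vL) /Jn.
Qed.

Section lower_bound.
Local Open Scope ring_scope.
Variables (q : nat).

(** A family stable under integration over the half-line, which divides the coefficient of
    [expR (k * u)] by [k]. The last exponent is left free so that it can be taken large. *)
Definition trinom (a b c u : R) : R :=
  a * expR (2 * u) + b * expR (3 * u) + c * expR (q.+3%:R * u).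

Lemma is_derive_trinom a b c u :
  is_derive u 1 (trinom a b c) (trinom (2 * a) (3 * b) (q.+3%:R * c) u).
Proof.
have h (e k : R) : is_derive u 1 (fun u => e * expR (k * u)) (k * e * expR (k * u)).
  have h1 := @is_deriveZ R R R id k u 1 1 (is_derive_id u 1).
  have h2 := @is_derive1_comp R expR (fun u => k * u) u _ _ (is_derive_expR (k * u)) h1.
  have h3 := @is_deriveZ R R R (expR \o (fun u => k * u)) e u 1 _ h2.
  by apply: (is_derive_eq h3); rewrite /GRing.scale/=; ring.
have h2 := h a 2; have h3 := h b 3; have h4 := h c q.+3%:R.
exact: (is_deriveD (is_deriveD h2 h3) h4).
Qed.

Lemma continuous_trinom a b c : continuous (trinom a b c).
Proof.
move=> u; apply/differentiable_continuous/derivable1_diffP.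
by have [] := is_derive_trinom a b c u.
Qed.

Lemma trinom_ge0 a b c u : 0 <= a -> 0 <= b -> 0 <= c -> 0 <= trinom a b c u.
Proof. by move=> a0 b0 c0; rewrite !addr_ge0// mulr_ge0 ?expR_ge0. Qed.

Lemma trinom_cvg0 a b c v : trinom a b c (v - t) @[t --> +oo] --> 0.
Proof.
have h (e : R) (k : nat) : e * expR (k.+1%:R * (v - t)) @[t --> +oo] --> 0.
  rewrite (_ : (fun t => _) = fun t => e * expR (k.+1%:R * v) * expR (- (k.+1%:R * t))); last first.
    by apply/funext => t; rewrite mulrBr expRD mulrA.
  rewrite -[X in _ --> X](mulr0 (e * expR (k.+1%:R * v))); apply: cvgM; first exact: cvg_cst.
  apply: (@cvg_comp _ _ _ (fun t => k.+1%:R * t) (fun t => expR (- t)) _ (pinfty_nbhs R)).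
    exact: gt0_cvgMry.
  exact: cvgr_expR.
rewrite -[X in _ --> X]addr0 -[X in _ --> X + _]addr0.
by apply: cvgD; [apply: cvgD; [exact: (h a 1%N)|exact: (h b 2%N)]|exact: (h c q.+2)].
Qed.

Lemma integral_trinom a b c v : v < L -> 0 <= a -> 0 <= b -> 0 <= c ->
  (\int[leb]_(t in `[0%R, +oo[) (trinom a b c (v - t)%R)%:E =
  (trinom (a / 2) (b / 3) (c / q.+3%:R) v)%:E)%E.
Proof.
move=> vL a0 b0 c0.
have h := @integral_shift R (trinom (a / 2) (b / 3) (c / q.+3%:R)) (trinom a b c) v.
apply: h => //.
- move=> u _; have h := is_derive_trinom (a / 2) (b / 3) (c / q.+3%:R) u.
  by apply: (is_derive_eq h); rewrite ![_ * (_ / _)]mulrC !divfK.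
- by move=> u _; exact: trinom_ge0.
- by move=> u _; exact: continuous_trinom.
- exact: trinom_cvg0.
Qed.

(** [K] and [M] both bound the linearisation factor [expR (profile u)]. The bound with [K] tends to
    1 at -oo and is used on the [expR (2 * u)] part of the weight; the uniform bound [M] is used on
    the high power. *)
Variables (M K B C : R) (v1 : R).
Hypotheses (v1L : v1 < L) (K0 : 0 <= K) (B0 : 0 <= B) (C0 : 0 <= C) (M0 : 0 <= M).
Hypothesis hM : forall u, u <= v1 -> expR (profile u) <= M.
Hypothesis hK : forall u, u <= v1 -> expR (profile u) <= 1 + K * expR u.
Hypothesis hC : forall u, u <= v1 -> profile u - expR u <= C * expR (2 * u).
Hypothesis hV : forall u,
  trinom (1 / 2 / 2) (K / 3 / 3) (M * B / q.+3%:R / q.+3%:R) u <= trinom 1 0 B u / 2.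

(* Linearising the recursion at [expR (profile u)] maps the weight [V] to at
   most the double integral of [U], which [hV] bounds by [V / 2]. *)
Let V := trinom 1 0 B.
Let U := trinom 1 K (M * B).

Let V0 u : 0 <= V u. Proof. exact: trinom_ge0. Qed.

Let UV u : u <= v1 -> expR (profile u) * V u <= U u.
Proof.
move=> uv; rewrite /V /U /trinom mul0r addr0 mul1r mulrDr [X in _ <= X + _]addrC -addrA.
have -> : K * expR (3 * u) + (expR (2 * u) + M * B * expR (q.+3%:R * u)) =
   (1 + K * expR u) * expR (2 * u) + M * (B * expR (q.+3%:R * u)).
  rewrite (_ : 3 * u = u + 2 * u); last by ring.
  by rewrite expRD; ring.
apply: lerD; first by rewrite ler_wpM2r ?expR_ge0// hK.
by rewrite ler_wpM2r ?hM// mulr_ge0// expR_ge0.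
Qed.

Lemma phi_lower n u : u <= v1 ->
  ((expR (profile u - C / 2 ^+ n * V u))%:E <= phi n (expR u))%E.
Proof.
elim: n u => [|n IH] u uv1.
  rewrite /= lee_fin ler_expR ger0_norm ?expR_ge0// expr0 divr1.
  have := hC uv1; rewrite lerBlDr addrC -lerBlDr; apply: le_trans.
  rewrite lerB// ler_wpM2l// /V /trinom mul0r addr0 mul1r lerDl.
  by rewrite mulr_ge0// expR_ge0.
pose e := C / 2 ^+ n.
have e0 : 0 <= e by rewrite divr_ge0// exprn_ge0.
have uL : u < L := le_lt_trans uv1 v1L.
have sub w t : w <= v1 -> (`[0%R, +oo[%classic : set R) t -> w - t <= v1.
  by move=> wv1 /=; rewrite in_itv/= andbT => t0; rewrite (le_trans _ wv1)// gerBl.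
(* The tangent line of the exponential gives [expR (- (e * V w)) >= 1 - e * V w], and [UV] bounds
   the resulting loss. *)
have ptw w : w <= v1 ->
    ((expR (profile w) - 1)%:E <= (phi n (expR w) - 1) + (e * U w)%:E)%E.
  move=> wv1; rewrite EFinB addeAC leeB// -leeBlDr// (le_trans _ (IH _ wv1))//.
  rewrite -EFinB lee_fin -/e (le_trans (y := expR (profile w) * (1 - e * V w)))//.
    rewrite mulrBr mulr1 lerB// mulrCA ler_wpM2l//; exact: UV.
  by rewrite expRD ler_wpM2l ?expR_ge0// expR_ge1Dx.
have U0 a b c w : 0 <= a -> 0 <= b -> 0 <= c -> (0 <= (e * trinom a b c w)%:E)%E.
  by move=> *; rewrite lee_fin mulr_ge0// trinom_ge0.
have mU a b c w : measurable_fun (`[0, +oo[%classic : set R)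
    (fun t => (e * trinom a b c (w - t))%:E).
  apply/measurable_EFinP; apply: measurable_funTS; apply: measurable_funM => //.
  apply: measurableT_comp; last exact: measurable_funB.
  by apply: continuous_measurable_fun; exact: continuous_trinom.
have iU a b c w : w < L -> 0 <= a -> 0 <= b -> 0 <= c ->
    (\int[leb]_(t in `[0%R, +oo[) (e * trinom a b c (w - t)%R)%:E =
     (e * trinom (a / 2) (b / 3) (c / q.+3%:R) w)%:E)%E.
  move=> wL a0 b0 c0; under eq_integral do rewrite EFinM.
  rewrite ge0_integralZl_EFin//.
  - by rewrite integral_trinom// EFinM.
  - by move=> t _; rewrite lee_fin trinom_ge0.
  - apply: measurable_shift wL _ => w' _; exact: continuous_trinom.
have MB0 : 0 <= M * B by rewrite mulr_ge0.
(* The first integration compares [excess n] with [kin (profile w)]; the second, in [step2],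
   compares the exponent of [phi n.+1] with [profile u]. *)
have step1 w : w <= v1 -> ((kin (profile w))%:E <=
    excess n w + (e * trinom (1 / 2) (K / 3) (M * B / q.+3%:R) w)%:E)%E.
  move=> wv1; have wL := le_lt_trans wv1 v1L.
  rewrite -integral_expR_profile// -iU// -ge0_integralD//; last 4 first.
  - by move=> t _; exact: phi_sub_ge0.
  - exact: measurable_funTS (measurable_phi_expR n w).
  - by move=> t _; exact: U0.
  - exact: mU.
  apply: ge0_le_integral => //.
  - move=> t /(sub_ltL wL) /profile_gt0 p0.
    by rewrite lee_fin subr_ge0 -expR0 ler_expR ltW.
  - exact: (measurable_shift wL continuous_expR_profile).
  - by apply: emeasurable_funD; [exact: measurable_funTS (measurable_phi_expR n w)|exact: mU].
  - by move=> t /(sub _ _ wv1) /ptw.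
have step2 : ((profile u)%:E <= \int[leb]_(t in `[0%R, +oo[) excess n (u - t)%R +
    (e * trinom (1 / 2 / 2) (K / 3 / 3) (M * B / q.+3%:R / q.+3%:R) u)%:E)%E.
  have mE : measurable_fun (`[0, +oo[%classic : set R) (fun t => excess n (u - t)).
    apply: measurable_funTS; apply: measurableT_comp; first exact: measurable_excess.
    exact: measurable_funB.
  have c0 : 0 <= M * B / q.+3%:R by rewrite divr_ge0.
  rewrite -integral_kin_profile// -iU ?divr_ge0// -ge0_integralD//; last 3 first.
  - by move=> t _; exact: excess_ge0.
  - by move=> t _; apply: U0; rewrite ?divr_ge0.
  - exact: mU.
  apply: ge0_le_integral => //.
  - by move=> t _; rewrite lee_fin sqrtr_ge0.
  - exact: (measurable_shift uL continuous_kin_profile).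
  - by apply: emeasurable_funD; [exact: mE|exact: mU].
  - by move=> t /(sub _ _ uv1) /step1.
rewrite phiS_excess -[leLHS]/(expeR (profile u - C / 2 ^+ n.+1 * V u)%:E) lee_expeR.
rewrite EFinB leeBlDr// (le_trans step2)// leeD2l// lee_fin.
have -> : C / 2 ^+ n.+1 * V u = e * (V u / 2).
  by rewrite /e exprS; field; rewrite expf_neq0.
by rewrite ler_wpM2l.
Qed.

End lower_bound.

Lemma cvg_phi v : (v < L)%R -> phi n (expR v) @[n --> \oo] --> (expR (profile v))%:E.
Proof.
move=> vL; set x1 := profile v.
(* By [profile_le], g = [profile u] is at most [E * expR u] for [u <= v]. Then [K] comes from
   [expR g - 1 <= g * expR g], and [C] below from [g - g ^+ 2 / 2 <= expR u]. *)
pose M := expR x1; pose E := expR (x1 / 2); pose K := (E * M)%R.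
have M0 : (0 < M)%R by exact: expR_gt0.
have E0 : (0 < E)%R by exact: expR_gt0.
have K0 : (0 < K)%R by rewrite mulr_gt0.
(* With [q.+3 >= 4 * M], the two integrations bring the high-power term to at most a quarter, even
   after multiplication by [M]. *)
pose q := Num.bound (4 * M)%R.
(* With [S = expR u], the terms [B * S ^+ q.+3] and [K * S ^+ 3] coincide at [K * S = 2]. Up to that
   point the square absorbs the cubic term, beyond it the high power does. *)
pose B := (K * (K / 2) ^+ q)%R.
have B0 : (0 <= B)%R by rewrite mulr_ge0 ?exprn_ge0 ?divr_ge0// ltW.
pose C := (E ^+ 2 / 2)%R.
have C0 : (0 <= C)%R by rewrite divr_ge0 ?sqr_ge0.
have px u : (u <= v)%R -> (0 < profile u <= x1)%R.
  by move=> uv; rewrite profile_gt0 ?(le_lt_trans uv)//= profile_nd.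
have pe u : (u <= v)%R -> (profile u <= expR u * E)%R.
  move=> uv; have /andP[p0 p1] := px u uv.
  have := profile_le (le_lt_trans uv vL).
  rewrite expRN ler_pdivrMr ?expR_gt0// => /le_trans; apply.
  by rewrite ler_wpM2l ?expR_ge0// ler_expR ler_wpM2r.
have hM u : (u <= v)%R -> (expR (profile u) <= M)%R.
  by move=> /px /andP[_ p1]; rewrite ler_expR.
have hK u : (u <= v)%R -> (expR (profile u) <= 1 + K * expR u)%R.
  move=> uv; have /andP[p0 p1] := px u uv; have pE := pe u uv.
  rewrite -lerBlDl (le_trans (y := (profile u * expR (profile u))%R))//.
    have := expR_ge1Dx (- profile u)%R.
    rewrite -(ler_pM2l (expR_gt0 (profile u))) -expRD subrr expR0; lra.
  rewrite (_ : K * expR u = (expR u * E) * M)%R; last by rewrite /K; ring.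
  by apply: ler_pM; [exact: ltW|exact: expR_ge0|exact: pE|exact: hM].
have hC u : (u <= v)%R -> (profile u - expR u <= C * expR (2 * u))%R.
  move=> uv; have /andP[p0 p1] := px u uv; have pE := pe u uv.
  have h1 := profile_le (le_lt_trans uv vL).
  have h2 := expR_ge1Dx (- (profile u / 2))%R.
  have h3 : (profile u * (1 - profile u / 2) <= expR u)%R.
    by apply: le_trans h1; rewrite ler_pM2l.
  have h4 : (profile u ^+ 2 <= (expR u * E) ^+ 2)%R.
    by apply: lerXn2r; rewrite ?nnegrE ?mulr_ge0 ?expR_ge0 ?(ltW p0).
  have -> : (C * expR (2 * u) = (expR u * E) ^+ 2 / 2)%R.
    by rewrite expRM_natl /C; ring.
  move: h3 h4; rewrite !expr2; lra.
have qM : (4 * M <= q.+3%:R)%R.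
  have qb : (4 * M < q%:R)%R by rewrite archi_boundP// mulr_ge0// ltW.
  by rewrite (le_trans (ltW qb))// ler_nat leqW// leqW.
have hV u : (trinom q (1 / 2 / 2) (K / 3 / 3) (M * B / q.+3%:R / q.+3%:R) u <=
    trinom q 1 0 B u / 2)%R.
  rewrite /trinom !expRM_natl; set S := expR u.
  have S0 : (0 < S)%R by exact: expR_gt0.
  have p1 : (1 <= q.+3%:R :> R)%R by rewrite ler1n.
  have p0 : (0 < q.+3%:R :> R)%R by rewrite ltr0n.
  have aux2 (k h r : R) n : (k * h ^+ n * r ^+ n.+3 = k * r ^+ 3 * (h * r) ^+ n)%R.
    rewrite (exprD r 3 n) exprMn.
    by rewrite -[LHS]mulrA -[RHS]mulrA; congr (_ * _)%R; rewrite mulrCA.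
  have aux (m b p X : R) : (p != 0)%R ->
      (m * b / p / p * X = (4 * m / p / p) * (b * X / 4))%R by move=> ?; field.
  have h1 : (M * B / q.+3%:R / q.+3%:R * S ^+ q.+3 <= B * S ^+ q.+3 / 4)%R.
    have -> : (M * B / q.+3%:R / q.+3%:R * S ^+ q.+3 =
       (4 * M / q.+3%:R / q.+3%:R) * (B * S ^+ q.+3 / 4))%R.
      by apply: aux; rewrite gt_eqF.
    have BS4 : (0 <= B * S ^+ q.+3 / 4)%R.
      by rewrite divr_ge0// mulr_ge0// exprn_ge0// ltW.
    rewrite ler_piMl//.
    by rewrite !ler_pdivrMr// mul1r (le_trans qM)// ler_peMr// ltW.
  have h2 : (K / 3 / 3 * S ^+ 3 <= S ^+ 2 / 4 + B * S ^+ q.+3 / 4)%R.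
    have BS0 : (0 <= B * S ^+ q.+3)%R by rewrite mulr_ge0 ?exprn_ge0 ?(ltW S0) ?(ltW K0).
    have S20 : (0 < S ^+ 2)%R by rewrite exprn_gt0.
    have S3 : (S ^+ 3 = S * S ^+ 2)%R by rewrite exprS.
    have [KS|KS] := leP (K * S)%R 2%R.
      have h3 : (K * S * S ^+ 2 <= 2 * S ^+ 2)%R by rewrite ler_pM2r.
      rewrite S3; move: h3 BS0 S20; set X := (B * _)%R; set Y := (S ^+ 2)%R.
      rewrite (_ : K / 3 / 3 * (S * Y) = K * S * Y / 9)%R; last by field.
      set Z := (K * S * Y)%R; clearbody X Y Z; clear; move=> *; lra.
    have h3 : (K * S ^+ 3 <= B * S ^+ q.+3)%R.
      rewrite (_ : B * S ^+ q.+3 = K * S ^+ 3 * (K * S / 2) ^+ q)%R; last first.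
        by rewrite (_ : K * S / 2 = K / 2 * S)%R ?aux2// mulrAC.
      have KS3 : (0 <= K * S ^+ 3)%R by rewrite mulr_ge0 ?exprn_ge0// ltW.
      rewrite ler_peMr// exprn_ege1//.
      by rewrite ler_pdivlMr// mul1r ltW.
    have h4 : (0 <= K * S ^+ 3)%R by rewrite mulr_ge0 ?exprn_ge0 ?(ltW S0) ?(ltW K0).
    move: h3 h4 BS0 S20; set X := (B * _)%R; set Y := (S ^+ 2)%R.
    rewrite (_ : K / 3 / 3 * S ^+ 3 = K * S ^+ 3 / 9)%R; last by field.
    set Z := (K * S ^+ 3)%R; clearbody X Y Z; clear; move=> *; lra.
  move: h1 h2; set X := (M * B / _ / _ * _)%R; set Y := (B * S ^+ _)%R.
  set Z := (_ / 3 / 3 * _)%R; set A := (S ^+ 2)%R.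
  clearbody X Y Z A; clear; move=> *; lra.
have low n := @phi_lower q M K B C v vL (ltW K0) B0 C0 (ltW M0) hM hK hC hV n v (lexx v).
apply: (@squeeze_cvge _ _ _ _
   (fun n => (expR (x1 - C / 2 ^+ n * trinom q 1 0 B v))%:E) _ (fun=> (expR x1)%:E)).
- by apply: nearW => n; rewrite low /= phi_le_profile.
- apply: cvg_EFin; first exact: nearW.
  have h : (x1 - C / 2 ^+ n * trinom q 1 0 B v)%R @[n --> \oo] --> x1.
    rewrite -[X in _ --> X]subr0; apply: cvgB; first exact: cvg_cst.
    rewrite -[X in _ --> X](mul0r (trinom q 1 0 B v)); apply: cvgM; last exact: cvg_cst.
    rewrite -[X in _ --> X](mulr0 C); apply: cvgM; first exact: cvg_cst.
    under eq_fun do rewrite -exprVn.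
    by apply: cvg_expr; rewrite gtr0_norm ?invr_gt0// invf_lt1// ltr1n.
  exact: (cvg_comp _ _ h (@continuous_expR R x1)).
- exact: cvg_cst.
Qed.

End comparison.

(** * The limit variable *)

Section limit.
Context (d : measure_display) (T : measurableType d) (R : realType)
  (P : probability T R) (xi : seq nat -> nat -> T -> R * R) (W : T -> R).
Local Open Scope ereal_scope.
Hypothesis Bxi : branching P xi.
Hypothesis mW : measurable_fun setT W.
Hypothesis WnW : {ae P, forall w, Wn xi n w @[n --> \oo] --> (W w)%:E}.
Local Notation L := (ln (rstar R)).

Let mWn n : measurable_fun setT (Wn xi n).
Proof. by apply: measurable_Wn => u k; exact: branching_measurable Bxi u k. Qed.

Let mexpWn s n : measurable_fun setT (fun w => expeR (s%:E * Wn xi n w)).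
Proof.
apply: measurableT_comp; first exact: measurable_expeR.
exact: measurable_funeM.
Qed.

Let mexpW s : measurable_fun setT (fun w => (expR (s * W w))%:E).
Proof.
apply/measurable_EFinP; apply: measurableT_comp; first exact: measurable_expR.
exact: measurable_funM.
Qed.

Lemma W_ge0 : {ae P, forall w, (0 <= W w)%R}.
Proof.
apply: filterS WnW => w Ww; rewrite -lee_fin.
by apply: (cvge_to_ge Ww); apply: nearW => n; exact: Wn_ge0.
Qed.

Lemma cvg_mine (u : (\bar R)^nat) (l c : R) : u n @[n --> \oo] --> l%:E ->
  mine (u n) c%:E @[n --> \oo] --> mine l%:E c%:E.
Proof.
move=> /fine_cvgP[fu ul]; rewrite -EFin_min; apply: cvg_EFin.
  by move: fu; apply: filterS => n; case: (u n) => // r _; rewrite -EFin_min.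
have h : Num.min ((fine \o u) n) c @[n --> \oo] --> Num.min l c.
  rewrite minr_absE; under eq_fun do rewrite minr_absE.
  apply: cvgM; last exact: cvg_cst.
  apply: cvgB; first by apply: cvgD => //; exact: cvg_cst.
  by apply: cvg_norm; apply: cvgB => //; exact: cvg_cst.
apply: cvg_trans h; apply: near_eq_cvg.
by move: fu; apply: filterS => n /=; case: (u n) => // r _; rewrite -EFin_min.
Qed.

Section fixed_parameter.
Variable v : R.
Hypothesis vL : (v < L)%R.
Let s := expR v.
Let h := expR (profile v).
Let X n w := expeR (s%:E * Wn xi n w).
Let X' w := (expR (s * W w))%:E.
(** Truncating [X n] at this level amounts to truncating [Wn] at [k]. *)
Let c (k : nat) := expR (s * k%:R).

Let s0 : (0 < s)%R. Proof. exact: expR_gt0. Qed.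

Let X0 n w : 0 <= X n w. Proof. exact: expeR_ge0. Qed.

Let intX n : \int[P]_w X n w = phi n s.
Proof. by apply: expeR_Wn_mean => //; exact: ltW. Qed.

Let cvgX : {ae P, forall w, X n w @[n --> \oo] --> X' w}.
Proof.
apply: filterS WnW => w Ww.
rewrite /X' -[(expR _)%:E]/(expeR (s%:E * (W w)%:E)).
apply: (@cvg_expeR _ (fun n => s%:E * Wn xi n w)) => //.
by rewrite -EFinM ltNyr.
by apply: cvgeZl.
Qed.

Let cvg_trunc k : (\int[P]_w mine (X n w) (c k)%:E) @[n --> \oo] -->
  \int[P]_w mine (X' w) (c k)%:E.
Proof.
have [] // := @dominated_convergence _ _ _ P setT measurableT
  (fun n w => mine (X n w) (c k)%:E) (fun w => mine (X' w) (c k)%:E)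
  (cst (c k)%:E).
- by move=> n; apply: measurable_mine => //; exact: mexpWn.
- by apply: measurable_mine => //; exact: mexpW.
- by apply: filterS cvgX => w Xw _; exact: cvg_mine.
- exact: finite_measure_integrable_cst.
- apply: aeW => w n _; rewrite gee0_abs ?ge_min ?lexx ?orbT//.
  by rewrite le_min X0 lee_fin expR_ge0.
Qed.

(** Fatou's inequality in two steps: the limit in [n] is taken under a truncation, which monotone
    convergence then removes. *)
Let mgf_le : \int[P]_w X' w <= h%:E.
Proof.
have trunc k : \int[P]_w mine (X' w) (c k)%:E <= h%:E.
  apply: (cvge_to_le (@cvg_trunc k)); apply: nearW => n.
  apply: (le_trans (y := phi n s)); last exact: phi_le_profile.
  rewrite -intX; apply: ge0_le_integral => //.
  - by move=> w _; rewrite le_min X0 lee_fin expR_ge0.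
  - by apply: measurable_mine => //; exact: mexpWn.
  - exact: mexpWn.
  - by move=> w _; rewrite ge_min lexx.
have lim w : mine (X' w) (c k)%:E @[k --> \oo] --> X' w.
  apply: cvg_near_cst; near=> k; apply/min_idPl; rewrite lee_fin ler_expR ler_pM2l//.
  by near: k; exact: nbhs_infty_ger.
have mc : \int[P]_w X' w = limn (fun k => \int[P]_w mine (X' w) (c k)%:E).
  rewrite -monotone_convergence//.
  - by apply: eq_integral => w _; apply/esym/cvg_lim.
  - by move=> k; apply: measurable_mine => //; exact: mexpW.
  - by move=> k w _; rewrite le_min !lee_fin !expR_ge0.
  - move=> w _ j k jk; rewrite le_min ge_min lexx /= ge_min; apply/orP; right.
    by rewrite lee_fin ler_expR ler_pM2l// ler_nat.
rewrite mc; apply: lime_le; last exact: nearW.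
apply: ereal_nondecreasing_is_cvgn => j k jk; apply: ge0_le_integral => //.
- by move=> w _; rewrite le_min !lee_fin !expR_ge0.
- by apply: measurable_mine => //; exact: mexpW.
- by apply: measurable_mine => //; exact: mexpW.
- move=> w _; rewrite le_min ge_min lexx /= ge_min; apply/orP; right.
  by rewrite lee_fin ler_expR ler_pM2l// ler_nat.
Unshelve. all: by end_near. Qed.

(* Exponential moments at [s1 > s], bounded uniformly in [n], make the
   variables [X n] uniformly integrable. *)
Let mgf_ge : h%:E <= \int[P]_w X' w.
Proof.
pose v1 := ((v + L) / 2)%R; pose s1 := expR v1; pose h1 := expR (profile v1).
have v1L : (v1 < L)%R by rewrite /v1 ltr_pdivrMr// mulr_natr mulr2n ltrD2r.
have ss1 : (0 < s1 - s)%R by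
  rewrite subr_gt0 ltr_expR /v1 ltr_pdivlMr// mulr_natr mulr2n ltrD2l.
pose e (k : nat) := expR (- ((s1 - s) * k%:R)).
(* Where [Wn] exceeds [k], passing from [s1] to [s] in the exponent costs a factor at most [e k];
   elsewhere the truncation has no effect. *)
have ptw n k w : X n w <= mine (X n w) (c k)%:E + (e k)%:E * expeR (s1%:E * Wn xi n w).
  have := Wn_ge0 xi n w; rewrite /X; case: (Wn xi n w) => [y|_|//].
    rewrite lee_fin => y0.
    rewrite -!EFinM /= -?EFin_min -?EFinM -?EFinD lee_fin.
    have [yk|ky] := leP y k%:R.
      rewrite (min_idPl _) ?lerDl ?mulr_ge0 ?expR_ge0//.
      by rewrite ler_expR ler_pM2l.
    apply: ler_wpDl; first by rewrite le_min !expR_ge0.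
    rewrite /e -expRD ler_expR -subr_ge0.
    have -> : (- ((s1 - s) * k%:R) + s1 * y - s * y = (s1 - s) * (y - k%:R))%R by ring.
    by rewrite mulr_ge0 ?ltW// subr_gt0.
  have E1 : s%:E * +oo = +oo by rewrite gt0_muley// lte_fin.
  have E2 : s1%:E * +oo = +oo by rewrite gt0_muley// lte_fin expR_gt0.
  by rewrite E1 E2 /= gt0_muley ?lte_fin ?expR_gt0// addey// -EFin_min.
(* The limit in [n] is taken at fixed [k]; the error [e k * h1] is independent of [n] and vanishes
   as [k] grows. *)
have bound k : h%:E <= \int[P]_w X' w + (e k * h1)%:E.
  have hk : h%:E <= \int[P]_w mine (X' w) (c k)%:E + (e k * h1)%:E.
    have cv : (\int[P]_w mine (X n w) (c k)%:E + (e k * h1)%:E) @[n --> \oo] -->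
        \int[P]_w mine (X' w) (c k)%:E + (e k * h1)%:E.
      apply: cvgeD; last exact: cvg_cst.
        by rewrite fin_num_adde_defl.
      exact: cvg_trunc.
    apply: (lee_cvg_to (cvg_phi vL) cv).
    apply: nearW => n; rewrite -intX.
    apply: (@le_trans _ _ (\int[P]_w (mine (X n w) (c k)%:E +
        (e k)%:E * expeR (s1%:E * Wn xi n w)))).
      apply: ge0_le_integral => //.
      - exact: mexpWn.
      - apply: emeasurable_funD; first by apply: measurable_mine => //; exact: mexpWn.
        by apply: measurable_funeM; exact: mexpWn.
    rewrite ge0_integralD//; last 4 first.
    - by move=> w _; rewrite le_min X0 lee_fin expR_ge0.
    - by apply: measurable_mine => //; exact: mexpWn.
    - by move=> w _; rewrite mule_ge0 ?expeR_ge0// lee_fin expR_ge0.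
    - by apply: measurable_funeM; exact: mexpWn.
    rewrite leeD2l// ge0_integralZl_EFin;
      [|by []|by move=> w _; exact: expeR_ge0|exact: mexpWn|exact: expR_ge0].
    rewrite expeR_Wn_mean ?expR_ge0// EFinM lee_wpmul2l ?lee_fin ?expR_ge0//.
    exact: phi_le_profile.
  rewrite (le_trans hk)// leeD2r//; apply: ge0_le_integral => //.
  - by move=> w _; rewrite le_min !lee_fin !expR_ge0.
  - by apply: measurable_mine => //; exact: mexpW.
  - exact: mexpW.
  - by move=> w _; rewrite ge_min lexx.
have fX : \int[P]_w X' w \is a fin_num.
  rewrite ge0_fin_numE; first by rewrite (le_lt_trans mgf_le)// ltry.
  by apply: integral_ge0 => w _; rewrite lee_fin expR_ge0.
move: bound; rewrite -(fineK fX); set I := fine _ => bound.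
rewrite lee_fin.
have cvI : (I + e k * h1)%R @[k --> \oo] --> I.
  rewrite -[X in _ --> X]addr0; apply: cvgD; first exact: cvg_cst.
  rewrite -(mul0r h1); apply: cvgM; last exact: cvg_cst.
  apply: (@cvg_comp _ _ _ (fun k : nat => k%:R : R)
    (fun t => expR (- ((s1 - s) * t)))%R _ (pinfty_nbhs R)); first exact: cvgr_idn.
  apply: (@cvg_comp _ _ _ (fun t => (s1 - s) * t)%R (fun t => expR (- t)) _
    (pinfty_nbhs R)); [exact: gt0_cvgMry|exact: cvgr_expR].
apply: (cvgr_to_ge cvI); apply: nearW => k.
by have := bound k; rewrite -EFinD lee_fin.
Qed.

Lemma mgf_profile : mgf P W (expR v) = (expR (profile v))%:E.
Proof. by apply/eqP; rewrite eq_le; apply/andP; split; [exact: mgf_le|exact: mgf_ge]. Qed.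

End fixed_parameter.

Lemma mgf_nd r r' : (r <= r')%R -> mgf P W r <= mgf P W r'.
Proof.
move=> rr'; apply: ae_ge0_le_integral => //.
by apply: filterS W_ge0 => w w0 _; rewrite lee_fin ler_expR ler_wpM2r.
Qed.

Lemma mgf_Finv r : (0 < r)%R -> (r < rstar R)%R ->
  mgf P W r = (Finv (L - ln r)%R)%:E.
Proof.
move=> r0 rr; have rs0 : (0 < rstar R)%R by exact: expR_gt0.
rewrite FinvE// -mgf_profile ?lnK ?posrE//.
by rewrite ltr_ln ?posrE.
Qed.

(** At [expR (clock x)], which is below [rstar R] for every positive [x], the generating function
    equals [expR x]. Monotonicity carries these unbounded values over to [r]. *)
Lemma mgf_infty r : (rstar R < r)%R -> mgf P W r = +oo.
Proof.
move=> rr; have rs0 : (0 < rstar R)%R by exact: expR_gt0.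
have lower x : (0 < x)%R -> (expR x)%:E <= mgf P W r.
  move=> x0; rewrite -(clockK x0) -mgf_profile ?clock_ltL//.
  apply: mgf_nd; rewrite (le_trans _ (ltW rr))//.
  by rewrite -[leRHS]lnK ?posrE// ler_expR ltW// clock_ltL.
apply/eqyP => A _; have := lower (Num.max A 1%R).
have m0 : (0 < Num.max A 1)%R by rewrite lt_max ltr01 orbT.
move=> /(_ m0); apply: le_trans; rewrite lee_fin.
rewrite (le_trans _ (expR_ge1Dx _))// (@le_trans _ _ (Num.max A 1%R)%R)//.
  by rewrite le_max lexx.
by rewrite lerDr.
Qed.

End limit.

Theorem theorem1p1 (d : measure_display) (T : measurableType d) (R : realType)
  (P : probability T R) (xi : seq nat -> nat -> T -> R * R) (W : T -> R) :
  (forall u, lebesgue_PPP P (xi u)) ->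
  mutually_indep P xi ->
  measurable_fun setT W ->
  {ae P, forall w, Wn xi n w @[n --> \oo] --> (W w)%:E} ->
  ereal_sup [set r%:E | r in [set r : R | (mgf P W r < +oo)%E]] = (rstar R)%:E /\
  forall r : R, 0 < r -> r < rstar R ->
    mgf P W r = (Finv (ln (rstar R) - ln r))%:E.
Proof.
move=> xiP ixi mW WnW; have Bxi : branching P xi by [].
split; last exact: mgf_Finv.
have rs0 : 0 < rstar R by exact: expR_gt0.
apply/eqP; rewrite eq_le; apply/andP; split.
  apply: ge_ereal_sup => _ [r /= mr <-]; rewrite lee_fin leNgt; apply/negP => rr.
  by move: mr; rewrite (mgf_infty Bxi mW WnW rr) ltxx.
apply/lee_subgt0Pr => e e0; rewrite -EFinB.
(* The maximum with [rstar R / 2] keeps [r] positive when [e] is large, as [mgf_Finv] requires. *)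
pose r := Num.max (rstar R - e) (rstar R / 2).
have r0 : 0 < r by rewrite lt_max divr_gt0// orbT.
have rr : r < rstar R by rewrite gt_max; apply/andP; split; lra.
apply: (@le_trans _ _ r%:E); first by rewrite lee_fin le_max lexx.
apply: ereal_sup_ubound; exists r => //=.
by rewrite (mgf_Finv Bxi mW WnW r0 rr) ltry.
Qed.
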